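(* Let $H$ be a separable Hilbert space, let $X$ be an $H$-valued random variable satisfying assumptions (A1) and (A2) given in the context, and let $m$ be its geometric median. Let $\alpha\in(1/2,1)$, $c_\gamma>0$, $\gamma_n=c_\gamma n^{-\alpha}$, let $(Z_n)_{n\ge 1}$ be the stochastic gradient sequence $$Z_{n+1}=Z_n+\gamma_n\frac{X_{n+1}-Z_n}{\|X_{n+1}-Z_n\|},\qquad n\ge 1,$$ where $X_1,X_2,\dots$ are independent copies of $X$ and $Z_1$ is bounded, and let $\overline{Z}_n=\frac1n\sum_{k=1}^n Z_k$ be its averaged version. Then for all integers $p\ge 1$ there is a positive constant $A_p$ such that for all $n\ge 1$, $$\mathbb{E}\left[\|\overline{Z}_n-m\|^{2p}\right]\le \frac{A_p}{n^{p}}.$$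
   Context: $H$ is a separable Hilbert space (possibly infinite dimensional) with inner product $\langle\cdot,\cdot\rangle$ and norm $\|\cdot\|$. The geometric median of $X$ is $m:=\arg\min_{h\in H}\mathbb{E}[\|X-h\|-\|X\|]$. No moment assumption is made on $X$. Assumptions: (A1) For all $h\in H$ there is $h'\in H$ such that $\langle h,h'\rangle=0$ and $\mathrm{Var}(\langle X,h'\rangle)>0$. (This ensures that $m$ is uniquely defined.) (A2) There is a positive constant $C$ such that for all $h\in H$, $\mathbb{E}[1/\|X-h\|]\le C$ and $\mathbb{E}[1/\|X-h\|^2]\le C$. $X_1,X_2,\dots$ are independent random variables with the same law as $X$. The initialization $Z_1$ is bounded (for instance $Z_1=X_1\mathbf 1_{\{\|X_1\|\le M\}}$ with $M$ a constant) or deterministic; it is measurable with respect to $\sigma(X_1)$. The event $X_{n+1}=Z_n$ has probability zero under (A2). *)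

(* Defs.v *)
From HB Require Import structures.
From mathcomp Require Import all_boot all_order all_algebra.
From mathcomp Require Import finmap sesquilinear.
From mathcomp Require Import all_classical all_reals all_analysis.
Set Implicit Arguments.
Unset Strict Implicit.
Unset Printing Implicit Defensive.
Import Order.TTheory GRing.Theory Num.Theory.
Import numFieldNormedType.Exports.
Local Open Scope classical_set_scope.
Local Open Scope ring_scope.

Definition separable (T : topologicalType) : Prop :=
  exists2 D : set T, countable D & dense D.

(* A real Hilbert space is a complete normed module [H] together with a
   symmetric positive definite bilinear form whose associated norm is the norm
   of [H]. *)
Definition induces_norm (R : realType) (H : completeNormedModType R)
    (inner : {dot H for idfun}) : Prop :=
  forall x : H, inner x x = `|x| ^+ 2.

Definition borel (T : ptopologicalType) := g_sigma_algebraType (@open T).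

Section RandomElements.
Context {d : measure_display} {T : measurableType d} {R : realType}.
Context (P : probability T R).

Definition sigma_of (H : ptopologicalType) (f : T -> H) : set (set T) :=
  preimage_set_system setT f (@measurable _ (borel H)).

(* Only measurable sets are tested: a [measure] has no meaning elsewhere. *)
Definition same_law d' (E : measurableType d') (X Y : {RV P >-> E}) : Prop :=
  forall A : set E, measurable A -> distribution P X A = distribution P Y A.

Definition mutually_independent (I : choiceType) d' (E : measurableType d')
    (X : I -> {RV P >-> E}) : Prop :=
  forall (J : {fset I}) (A : I -> set E),
    (forall i, measurable (A i)) ->
    P (\bigcap_(i in [set` J]) (X i @^-1` A i)) =
      (\prod_(i <- J) P (X i @^-1` A i))%E.

Section Hilbert.
Context {H : completeNormedModType R}.
Local Open Scope ereal_scope.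

(* [X] has no moments in general. The library variance is
   E[(Y - c)^2] with c = E[Y] when this is finite, and c is a junk real number
   otherwise; in the latter case Y is not square integrable and the value is
   +oo, as it should be. *)
Definition nondegenerate_orthogonally (inner : {dot H for idfun})
    (X : T -> H) : Prop :=
  forall h : H, exists2 h' : H,
    inner h h' = 0%R & 0 < 'V_P[fun w => inner (X w) h'].

(* The inverses are taken in [\bar R], where the inverse of 0 is +oo; inverses
   in [R], where the inverse of 0 is 0, would ignore the event [X = h]. *)
Definition bounded_inverse_moments (X : T -> H) : Prop :=
  exists2 C : R, (0 < C)%R & forall h : H,
    \int[P]_w ((`|X w - h|)%:E)^-1 <= C%:E /\
    \int[P]_w ((`|X w - h| ^+ 2)%:E)^-1 <= C%:E.

Definition geometric_median (X : T -> H) (m : H) : Prop :=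
  forall h : H,
    'E_P[fun w => (`|X w - m| - `|X w|)%R] <=
    'E_P[fun w => (`|X w - h| - `|X w|)%R].

Local Open Scope ring_scope.

Definition step_size (cg alpha : R) (n : nat) : R := cg * n%:R `^ (- alpha).

(* Indices start at 1; [Z 0] and [X 0] are never used. When [X n.+1 w = Z n w],
   which has probability zero, the increment is 0. *)
Definition stochastic_gradient (gamma : nat -> R) (X Z : nat -> T -> H)
    : Prop :=
  forall n w, (1 <= n)%N ->
    Z n.+1 w = Z n w
      + gamma n *: (`|X n.+1 w - Z n w|^-1 *: (X n.+1 w - Z n w)).

Definition averaged (Z : nat -> T -> H) (n : nat) (w : T) : H :=
  n%:R^-1 *: \sum_(1 <= k < n.+1) Z k w.

End Hilbert.
End RandomElements.

(* Main.v *)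
(* Let Phi be the gradient of the objective, so that Phi(m) = 0, and let
   U_k = (Z_k - X_{k+1}) / |Z_k - X_{k+1}|, whose conditional mean is Phi(Z_k).

   A Cauchy-Schwarz defect computation bounds <h - m, Phi(h)> below by
   c |h - m|^2 / (1 + |h - m|), where c > 0 because the law of X is not
   carried by a line through m. For psi = exp(sqrt(1 + |Z - m|^2) - 1) - 1 this
   drift is at least proportional to psi, near m and at infinity alike, hence
   E psi_{n+1}^q <= (1 - a gamma_n) E psi_n^q + K gamma_n^{q+1} and every moment
   satisfies E |Z_n - m|^{2q} = O(gamma_n^q).

   Linearising Phi at m, where the second derivative is coercive, bounds
   |sum_{k<=n} (Z_k - m)| by the sum of |sum (Phi(Z_k) - U_k)|, a martingale with
   bounded increments, |sum U_k| = |sum (Z_k - Z_{k+1}) / gamma_k|, treated by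
   Abel summation, and sum |Z_k - m|^2. Since 1/2 < alpha < 1, each of them is
   of order sqrt n in every L^{2p}. *)
Require Import Defs.
From HB Require Import structures.
From mathcomp Require Import all_boot all_order all_algebra.
From mathcomp Require Import finmap sesquilinear.
From mathcomp Require Import all_classical all_reals all_analysis.
From mathcomp Require Import measurable_realfun.
From mathcomp Require Import ring lra.
Set Implicit Arguments.
Unset Strict Implicit.
Unset Printing Implicit Defensive.
Import Order.TTheory GRing.Theory Num.Theory.
Import numFieldNormedType.Exports.
Local Open Scope classical_set_scope.
Local Open Scope ring_scope.

(** * Geometry of directions in a Hilbert space *)

(** Two obstacles shape the proof: [X] has no moments, and the unit sphere of [H] need not be
    compact. Because of the first, integrands are either bounded or dominated by inverse distances,
    which (A2) controls; this is why the Cauchy-Schwarz defect carries the weight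
    [(1 + |m - X|)^-1]. Because of the second, positivity of the averaged defect in each direction
    does not yield a uniform constant; the constant comes from comparing an arbitrary direction with
    the random directions of [m - X]. The iterates cause no integrability problem: they start
    bounded and move by at most [gamma_n]. Conditional expectations are replaced by Fubini on the
    joint law of the past and the next sample. The summed quadratic error of the linearisation must
    be of order sqrt n in L^{2p}, which asks for moments of order 4p of [Z_n - m] at their exact
    rate; hence the arbitrary powers of [psi]. The condition [alpha > 1/2] gives sum gamma_k =
    O(sqrt n). The condition [alpha < 1] gives n gamma_n -> oo, so that a contraction by
    [1 - a gamma_n] beats the relative decay, of order 1/n, of the target rate. *)

Section HilbertGeometry.
Context (R : realType) (H : completeNormedModType R) (inner : {dot H for idfun}).
Context (hilbertH : induces_norm inner).
Local Notation "''[' u , v ]" := (inner u v).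
Implicit Types (u v w x a b e f : H) (r : R).

Lemma innerC u v : '[u, v] = '[v, u].
Proof. by rewrite [LHS](@hermC _ _ _ _ inner) expr0 mul1r. Qed.

Lemma innerDl u v w : '[u + v, w] = '[u, w] + '[v, w].
Proof. exact: linearDl. Qed.

Lemma innerDr u v w : '[w, u + v] = '[w, u] + '[w, v].
Proof. exact: linearDr. Qed.

Lemma innerZl r u w : '[r *: u, w] = r * '[u, w].
Proof. by rewrite linearZl_LR. Qed.

Lemma innerZr r u w : '[w, r *: u] = r * '[w, u].
Proof. by rewrite linearZr_LR. Qed.

Lemma innerBl u v w : '[u - v, w] = '[u, w] - '[v, w].
Proof. exact: linearBl. Qed.

Lemma innerBr u v w : '[w, u - v] = '[w, u] - '[w, v].
Proof. exact: linearBr. Qed.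

Lemma inner_sumr I (s : seq I) (F : I -> H) w :
  '[w, \sum_(i <- s) F i] = \sum_(i <- s) '[w, F i].
Proof. by rewrite linear_sumr. Qed.

Lemma innerxx u : '[u, u] = `|u| ^+ 2.
Proof. exact: hilbertH. Qed.

Definition innerE := (innerBl, innerBr, innerDl, innerDr, innerZl, innerZr).

Lemma normD_sqr u v : `|u + v| ^+ 2 = `|u| ^+ 2 + 2 * '[u, v] + `|v| ^+ 2.
Proof. rewrite -!innerxx !innerE.  by rewrite (innerC v u); ring. Qed.

Lemma normB_sqr u v : `|u - v| ^+ 2 = `|u| ^+ 2 - 2 * '[u, v] + `|v| ^+ 2.
Proof. rewrite -!innerxx !innerE.  by rewrite (innerC v u); ring. Qed.

Lemma normD_sqr_le u v : `|u + v| ^+ 2 <= 2 * `|u| ^+ 2 + 2 * `|v| ^+ 2.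
Proof.
have := sqr_ge0 `|u - v|; rewrite normB_sqr => h.
by rewrite normD_sqr; lra.
Qed.

Lemma cauchy_schwarz u v : `|'[u, v]| <= `|u| * `|v|.
Proof.
rewrite -(@ler_pXn2r _ 2)// ?nnegrE ?mulr_ge0// real_normK ?num_real//.
have [->|v0] := eqVneq v 0.
  by rewrite -(scale0r (0 : H)) innerZr mul0r expr0n sqr_ge0.
have /ler_pM2l <- : 0 < `|v| ^+ 2 by rewrite exprn_gt0 ?normr_gt0.
rewrite -subr_ge0 exprMn.
suff -> : `|v| ^+ 2 * (`|u| ^+ 2 * `|v| ^+ 2) - `|v| ^+ 2 * '[u, v] ^+ 2
  = `|(`|v| ^+ 2) *: u - '[u, v] *: v| ^+ 2 by exact: sqr_ge0.
by rewrite -!innerxx !innerE (innerC v u); ring.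
Qed.

Lemma inner_le u v : '[u, v] <= `|u| * `|v|.
Proof. exact: le_trans (ler_norm _) (cauchy_schwarz _ _). Qed.

Definition dir (x : H) : H := `|x|^-1 *: x.

Lemma norm_dirK x : `|x| *: dir x = x.
Proof.
have [->|x0] := eqVneq x 0; first by rewrite /dir !scaler0.
by rewrite scalerA mulfV ?scale1r// normr_eq0.
Qed.

Lemma dir0 : dir 0 = 0.
Proof. exact: scaler0. Qed.

Lemma dirN x : dir (- x) = - dir x.
Proof. by rewrite /dir normrN scalerN. Qed.

Lemma norm_dir x : x != 0 -> `|dir x| = 1.
Proof. by move=> x0; rewrite normrZ normfV normr_id mulVf// normr_eq0. Qed.

Lemma norm_dir_le1 x : `|dir x| <= 1.
Proof.
have [->|x0] := eqVneq x 0; first by rewrite /dir scaler0 normr0.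
by rewrite norm_dir.
Qed.

(** Only [|b|] is in the denominator and [a] may vanish, so that one inverse moment is enough after
    integration. *)
Lemma dir_lipschitz a b : b != 0 -> `|dir a - dir b| <= 2 * `|a - b| / `|b|.
Proof.
move=> b0; rewrite ler_pdivlMr ?normr_gt0// mulrC -[X in X * _]normr_id -normrZ.
have -> : `|b| *: (dir a - dir b) = (`|b| - `|a|) *: dir a + (a - b).
  by rewrite scalerBr norm_dirK scalerBl norm_dirK addrA subrK.
apply: le_trans (ler_normD _ _) _; rewrite mulr2n mulrDl mul1r lerD2r normrZ.
rewrite -[leRHS]mulr1 ler_pM ?norm_dir_le1// distrC.
exact: ler_dist_dist.
Qed.

Lemma inner_dir_monotone a b : a != 0 -> b != 0 ->
  `|a - b| ^+ 2 - '[a - b, dir b] ^+ 2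
    <= 2 * `|a| * '[a - b, dir a - dir b].
Proof.
move=> a0 b0.
have := inner_le a b; have := inner_le (- a) b.
rewrite normrN -scaleN1r innerZl mulN1r normB_sqr /dir !innerE (innerC b a) !innerxx.
have : 0 < `|a| by rewrite normr_gt0.
have : 0 < `|b| by rewrite normr_gt0.
move: `|a| `|b| '[a, b] => A B s B0 A0 h1 h2.
(* [r] is the cosine of the angle between [a] and [b]; in terms of it the gap factors with [1 - r]
   and has a visible sign. *)
have [r rE] : exists r, s = r * (A * B).
  by exists (s / (A * B)); rewrite divfK// mulf_neq0 ?gt_eqF.
rewrite {}rE in h1 h2 *.
have hA : A != 0 by rewrite gt_eqF.
have hB : B != 0 by rewrite gt_eqF.
have AB0 : 0 < A * B by exact: mulr_gt0.
have r1 : r <= 1 by rewrite -(ler_pM2r AB0) mul1r.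
have r2 : - r <= 1 by rewrite -(ler_pM2r AB0) mul1r mulNr.
rewrite -subr_ge0.
rewrite [X in 0 <= X](_ : _ = (1 - r) * (A ^+ 2 * (1 - r) + 2 * (A * B))); last first.
  by field; rewrite hA hB.
have r0 : 0 <= 1 - r by rewrite subr_ge0.
by rewrite mulr_ge0// addr_ge0 ?mulr_ge0 ?sqr_ge0 ?(ltW A0) ?(ltW B0).
Qed.

(* The bilinear form on the right is the second derivative of the norm. *)
Lemma inner_dir_taylor v a b : b != 0 ->
  `|'[v, dir a - dir b] - ('[v, a - b] - '[v, dir b] * '[a - b, dir b]) / `|b| |
    <= 5 / 2 * `|v| * `|a - b| ^+ 2 / `|b| ^+ 2.
Proof.
move=> b0; have B0 : 0 < `|b| by rewrite normr_gt0.
have hB : `|b| != 0 by rewrite gt_eqF.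
(* The Taylor remainder is an exact expression. Its first part is bounded by [dir_lipschitz] and
   contributes 2; its second part contributes 1/2, because [|a||b| - '[a, b]] is at most half of
   [|a - b| ^+ 2]. *)
have -> : '[v, dir a - dir b] - ('[v, a - b] - '[v, dir b] * '[a - b, dir b]) / `|b|
  = '[v, ((`|b| - `|a|) / `|b|) *: (dir a - dir b)
       + (('[a, b] - `|a| * `|b|) / `|b| ^+ 2) *: dir b].
  have e1 : '[v, a] = `|a| * '[v, dir a] by rewrite -innerZr norm_dirK.
  have e2 : '[v, b] = `|b| * '[v, dir b] by rewrite -innerZr norm_dirK.
  have e3 : '[a, dir b] = '[a, b] / `|b| by rewrite /dir innerZr mulrC.
  have e4 : '[b, dir b] = `|b| by rewrite /dir innerZr innerxx expr2 mulKf.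
  move: (dir a) (dir b) e1 e2 e3 e4 => da db e1 e2 e3 e4.
  by rewrite !innerE e1 e2 e3 e4; field.
apply: le_trans (cauchy_schwarz _ _) _.
rewrite [5 / 2 * _]mulrC -!mulrA ler_wpM2l//.
apply: le_trans (ler_normD _ _) _.
rewrite (normrZ _ (dir b)) (normrZ _ (dir a - dir b)) norm_dir// mulr1 !normrM !normfV normrX normr_id.
have h1 : `| `|b| - `|a| | <= `|a - b| by rewrite distrC ler_dist_dist.
have h2 := dir_lipschitz a b0.
have h3 : `| '[a, b] - `|a| * `|b| | <= `|a - b| ^+ 2 / 2.
  rewrite distrC ger0_norm ?subr_ge0 ?inner_le//.
  have := sqr_ge0 (`|a| - `|b|).
  by rewrite normB_sqr; nra.
apply: (@le_trans _ _ (`|a - b| / `|b| * (2 * `|a - b| / `|b|)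
    + `|a - b| ^+ 2 / 2 / `|b| ^+ 2)).
  apply: lerD; last by rewrite ler_wpM2r// invr_ge0 exprn_ge0.
  by apply: ler_pM => //; rewrite ler_wpM2r// invr_ge0.
by rewrite le_eqVlt; apply/orP; left; apply/eqP; field.
Qed.

(* The sine of the angle between lines obeys a triangle inequality. *)
Lemma sin_sqr_triangle u e f : `|u| <= 1 -> `|e| = 1 -> `|f| = 1 ->
  `|u| ^+ 2 - '[u, f] ^+ 2
    <= 2 * (`|u| ^+ 2 - '[u, e] ^+ 2) + 2 * (1 - '[e, f] ^+ 2).
Proof.
move=> u1 e1 f1.
set a := '[u, e]; set c := '[e, f].
have a1 : a ^+ 2 <= 1.
  rewrite -(ler_pXn2r (n:=1)) // ?nnegrE ?sqr_ge0// !expr1 -real_normK ?num_real//.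
  apply: exprn_ile1 => //; apply: le_trans (cauchy_schwarz _ _) _.
  by rewrite e1 mulr1.
have c1 : c ^+ 2 <= 1.
  rewrite -(ler_pXn2r (n:=1)) // ?nnegrE ?sqr_ge0// !expr1 -real_normK ?num_real//.
  apply: exprn_ile1 => //; apply: le_trans (cauchy_schwarz _ _) _.
  by rewrite e1 f1 mulr1.
(* The left side is the squared distance from [u] to the line of [f]. It is compared with one point
   of that line, reached by projecting [u] on [e] and the result on [f]. *)
have h1 : `|u| ^+ 2 - '[u, f] ^+ 2 <= `|u - (a * c) *: f| ^+ 2.
  rewrite normB_sqr innerZr normrZ f1 mulr1 real_normK ?num_real//.
  by have := sqr_ge0 ('[u, f] - a * c); nra.
apply: (le_trans h1).
have -> : u - (a * c) *: f = (u - a *: e) + a *: (e - c *: f).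
  by rewrite scalerBr scalerA addrA subrK.
have h2 := normD_sqr_le (u - a *: e) (a *: (e - c *: f)).
apply: (le_trans h2); apply: lerD; rewrite ler_wpM2l//.
  rewrite normB_sqr innerZr normrZ e1 mulr1 real_normK ?num_real// -/a.
  by nra.
rewrite normrZ exprMn real_normK ?num_real//.
have -> : `|e - c *: f| ^+ 2 = 1 - c ^+ 2.
  rewrite normB_sqr innerZr normrZ e1 f1 mulr1 real_normK ?num_real// -/c.
  by ring.
by rewrite -[leRHS]mul1r ler_wpM2r// subr_ge0.
Qed.

End HilbertGeometry.

(** * Riesz representation, the source of vector-valued expectations *)

Section Riesz.
Context (R : realType) (H : completeNormedModType R) (inner : {dot H for idfun}).
Context (hilbertH : induces_norm inner).
Local Notation "''[' u , v ]" := (inner u v).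
Implicit Types (u v w x : H) (r : R).

(* Minimise |x|^2 - 2 L x; an approximate minimiser represents L up to a small
   error, so a minimising sequence is Cauchy. *)
Lemma riesz_representation (L : H -> R) (K : R) :
    (forall u v, L (u + v) = L u + L v) -> (forall r u, L (r *: u) = r * L u) ->
    (forall u, `|L u| <= K * `|u|) ->
  exists v, forall u, '[u, v] = L u.
Proof.
move=> LD LZ LK.
pose J x := `|x| ^+ 2 - 2 * L x.
have JK x : - K ^+ 2 <= J x.
  have := LK x; rewrite ler_norml => /andP[_ h]; rewrite /J.
  by have := sqr_ge0 (`|x| - K); nra.
have lbJ : has_lbound (range J).
  by exists (- K ^+ 2) => _ [x _ <-].
have infJ : has_inf (range J) by split => //; exists (J 0), 0.
pose j := inf (range J).
have /choice[xs xsE] : forall n, exists x, J x < j + n.+1%:R^-1 ^+ 2.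
  move=> n; have e0 : 0 < n.+1%:R^-1 ^+ 2 :> R by rewrite exprn_gt0// invr_gt0.
  by have [_ [x _ <-] lt] := inf_adherent e0 infJ; exists x.
have approx n u : `|'[u, xs n] - L u| <= n.+1%:R^-1 * `|u|.
  rewrite -(@ler_pXn2r _ 2)// ?nnegrE ?mulr_ge0// real_normK ?num_real// exprMn.
  have [->|u0] := eqVneq u 0.
    rewrite -(scale0r (0 : H)) LZ (innerZl inner) !mul0r subr0 expr0n/=.
    by rewrite mulr_ge0 ?sqr_ge0.
  have U0 : 0 < `|u| ^+ 2 by rewrite exprn_gt0// normr_gt0.
  set b := '[u, xs n] - L u.
  (* Along the line through [xs n] directed by [u], [J] is a quadratic whose minimum is at this
     point and lies [b ^+ 2 / |u| ^+ 2] below [J (xs n)]. *)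
  have h : j <= J (xs n + (- b / `|u| ^+ 2) *: u) by apply: ge_inf => //; exists (xs n + (- b / `|u| ^+ 2) *: u).
  have := xsE n; move: h; rewrite /J LD LZ (normD_sqr hilbertH) (innerZr inner) normrZ exprMn.
  rewrite (innerC inner (xs n) u) real_normK ?num_real//.
  have -> : '[u, xs n] = b + L u by rewrite subrK.
  move: (n.+1%:R^-1 ^+ 2) (`|xs n| ^+ 2) (L u) (L (xs n)) U0; move: (j).
  move: (`|u| ^+ 2) => U k e X l lx U0 h1 h2.
  rewrite -ler_pdivrMr//.
  have e1 : (- b / U) ^+ 2 * U = b ^+ 2 / U by field; rewrite gt_eqF.
  have e2 : - b / U * (b + l) = - (b ^+ 2 / U) - b / U * l by field; rewrite gt_eqF.
  move: h1. rewrite e1 e2 => h1.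
  have e3 : - b / U * l = - (b / U * l) by rewrite !mulNr.
  by move: h1; rewrite e3; lra.
(* Testing [approx] for both indices on the same vector [xs n - xs k] makes the value of [L]
   cancel. *)
have xsK n k : `|xs n - xs k| <= n.+1%:R^-1 + k.+1%:R^-1.
  have [->|d0] := eqVneq (xs n - xs k) 0; first by rewrite normr0 addr_ge0.
  have D0 : 0 < `|xs n - xs k| by rewrite normr_gt0.
  rewrite -(ler_pM2r D0) -expr2 -(innerxx hilbertH).
  have := approx n (xs n - xs k); have := approx k (xs n - xs k).
  rewrite (innerBr inner (xs n) (xs k) (xs n - xs k)).
  rewrite !ler_norml => /andP[a1 a2] /andP[a3 a4].
  move: a1 a2 a3 a4; rewrite mulrDl.
  move: (L _) (_ * `|_|) (_ * `|_|) => l p q a1 a2 a3 a4.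
  by lra.
have : cvg (xs @ \oo).
  apply: cauchy_cvg; apply/cauchy_exP => e e0.
  have e20 : 0 < e / 2 by rewrite divr_gt0.
  near \oo => N; exists (xs N).
  suff : \forall n \near \oo, ball (xs N) e (xs n) by [].
  near=> n.
  rewrite -ball_normE/=. apply: le_lt_trans (xsK _ _) _.
  rewrite [e]splitr; apply: ltrD.
    by near: N; exact: near_infty_natSinv_lt (PosNum e20).
  by near: n; exact: near_infty_natSinv_lt (PosNum e20).
move=> /cvg_ex[/= x xsx]; exists x => u.
apply/eqP; rewrite -subr_eq0 -normr_le0; apply/ler_addgt0Pr => e e0; rewrite add0r.
have U0 : 0 < 2 * (`|u| + 1) by rewrite mulr_gt0// ltr_wpDl.
have e'0 := divr_gt0 e0 U0; set e' := e / _ in e'0.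
near \oo => n.
have -> : '[u, x] - L u = ('[u, xs n] - L u) + '[u, x - xs n].
  by rewrite (innerBr inner); ring.
apply: le_trans (ler_normD _ _) _.
have h1 : n.+1%:R^-1 < e' by near: n; exact: near_infty_natSinv_lt (PosNum e'0).
have h2 : `|x - xs n| < e' by near: n; exact: cvgr_dist_lt xsx _ e'0.
apply: (@le_trans _ _ (e' * `|u| + `|u| * e')).
  apply: lerD; first by rewrite (le_trans (approx n u))// ler_wpM2r// ltW.
  by rewrite (le_trans (cauchy_schwarz hilbertH _ _))// ler_wpM2l// ltW.
rewrite (_ : e = e' * (2 * (`|u| + 1))); last by rewrite divfK// gt_eqF.
by have := normr_ge0 u; nra.
Unshelve. all: by end_near. Qed.

End Riesz.

(** * Measurability of Hilbert space valued functions *)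

Section BorelMeasurability.
Context (R : realType).

Lemma dense_sequence (V : normedModType R) : separable V ->
  exists s : nat -> V, forall (x : V) (e : R), 0 < e -> exists k, `|s k - x| < e.
Proof.
move=> [D /pcard_surjP[s sD] dD]; exists s => x e e0.
have [d [/= xd /sD[k _ skd]]] : exists d, (ball x e `&` D) d.
  by apply: dD; [exists x; exact: ballxx|exact: ball_open].
by exists k; rewrite skd distrC; move: xd; rewrite -ball_normE.
Qed.

Lemma separable_real : separable R^o.
Proof.
exists (@ratr R @` setT); last exact: (@dense_rat R).
by apply: sub_countable (card_image_le _ _) _; exact: countableP.
Qed.

Context d (D : measurableType d).

(** Stated through open sets alone, so that continuity arguments apply to any topological codomain;
    the two equivalences below translate it for the reals and for [borel H]. *)
Definition open_measurable_fun (V : topologicalType) (f : D -> V) :=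
  forall O, open O -> measurable (f @^-1` O).

Lemma continuous_open_measurable (V W : topologicalType) (F : V -> W) (f : D -> V) :
  continuous F -> open_measurable_fun f -> open_measurable_fun (F \o f).
Proof.
by move=> /continuousP cF mf O oO; rewrite comp_preimage; apply: mf; exact: cF.
Qed.

(** An open subset of the product is a countable union of boxes of balls with centres in the dense
    sequences and radii [1/(n+1)], and each box has a measurable preimage. Separability is what
    makes the union countable. *)
Lemma continuous2_open_measurable (U V : normedModType R) (W : topologicalType)
    (F : U * V -> W) (f : D -> U) (g : D -> V) :
  separable U -> separable V -> continuous F ->
  open_measurable_fun f -> open_measurable_fun g ->
  open_measurable_fun (fun x => F (f x, g x)).
Proof.
move=> /dense_sequence[s sP] /dense_sequence[t tP] /continuousP cF mf mg O oO.
pose G (i : nat * nat * nat) : set (U * V) :=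
  ball (s i.1.1) i.2.+1%:R^-1 `*` ball (t i.1.2) i.2.+1%:R^-1.
pose E i : set D := if `[< G i `<=` F @^-1` O >]
  then f @^-1` (ball (s i.1.1) i.2.+1%:R^-1) `&` g @^-1` (ball (t i.1.2) i.2.+1%:R^-1)
  else set0.
have -> : (fun x => F (f x, g x)) @^-1` O = \bigcup_i E i; last first.
  apply: countable_bigcupT_measurable => // i; rewrite /E.
  case: asboolP => // _.
  by apply: measurableI; [apply: mf|apply: mg]; exact: ball_open.
apply/seteqP; split=> x /=; last first.
  by move=> [i _]; rewrite /E; case: asboolP => // h [fx gx]; apply: (h (_, _)).
move=> FxO; have : nbhs (f x, g x) (F @^-1` O).
  by apply: open_nbhs_nbhs; split=> //; exact: cF.
move=> /nbhs_ballP[e /= e0 eO].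
have e20 : 0 < e / 2 by rewrite divr_gt0.
have [N _ /(_ N (leqnn N)) /= Ne] := near_infty_natSinv_lt (PosNum e20).
have N0 : 0 < N.+1%:R^-1 :> R by rewrite invr_gt0.
have [i si] := sP (f x) _ N0; have [j tj] := tP (g x) _ N0.
exists (i, j, N) => //; rewrite /E asboolT; last first.
  move=> [u v] [/=]; rewrite -!ball_normE /= => su tv; apply: eO; split; rewrite -ball_normE /=.
    rewrite -(subrK (s i) (f x)) -addrA [e]splitr.
    by apply: le_lt_trans (ler_normD _ _) _; apply: ltrD; [rewrite distrC|]; exact: lt_trans Ne.
  rewrite -(subrK (t j) (g x)) -addrA [e]splitr.
  by apply: le_lt_trans (ler_normD _ _) _; apply: ltrD; [rewrite distrC|]; exact: lt_trans Ne.
by split; rewrite /= -ball_normE.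
Qed.

Lemma open_measurable_realP (f : D -> R) :
  open_measurable_fun (f : D -> R^o) <-> measurable_fun setT f.
Proof.
split=> [mf|mf O oO].
  apply: (measurability _ (RGenOInfty.measurableE R)).
  by move=> _ [_ [a ->] <-]; rewrite setTI; apply: mf; exact: interval_open.
by rewrite -[_ @^-1` _]setTI; apply: mf => //; exact: open_measurable.
Qed.

Lemma open_measurable_borelP (H : ptopologicalType) (f : D -> H) :
  open_measurable_fun f <-> measurable_fun setT (f : D -> borel H).
Proof.
split=> [mf|mf O oO].
  apply: (@measurability _ _ _ (borel H) setT f (@open H)) => //.
  by move=> _ [U oU <-]; rewrite setTI; apply: mf.
by rewrite -[_ @^-1` _]setTI; apply: mf => //; exact: sub_gen_smallest.
Qed.

End BorelMeasurability.

Section HilbertMeasurability.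
Context (R : realType) (H : completeNormedModType R).
Context (separableH : separable H).
Context d (D : measurableType d).
Implicit Types (f g : D -> borel H) (r : D -> R).

Lemma measurable_continuous_real (F : H -> R) f : continuous F ->
  measurable_fun setT f -> measurable_fun setT (fun x => F (f x)).
Proof.
move=> cF /open_measurable_borelP mf; apply/open_measurable_realP.
exact: (@continuous_open_measurable _ _ H R^o F).
Qed.

Lemma measurable_continuous (F : H -> H) f : continuous F ->
  measurable_fun setT f -> measurable_fun setT (fun x => F (f x) : borel H).
Proof.
move=> cF /open_measurable_borelP mf; apply/open_measurable_borelP.
exact: (@continuous_open_measurable _ _ H H F).
Qed.

Lemma measurable_norm f : measurable_fun setT f ->
  measurable_fun setT (fun x => `|f x : H|).
Proof. by apply: measurable_continuous_real; exact: norm_continuous. Qed.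

Lemma measurable_addv f g : measurable_fun setT f -> measurable_fun setT g ->
  measurable_fun setT (fun x => ((f x : H) + (g x : H)) : borel H).
Proof.
move=> /open_measurable_borelP mf /open_measurable_borelP mg.
apply/open_measurable_borelP.
by apply: (@continuous2_open_measurable R _ _ H H H (fun z => z.1 + z.2)) => //;
  exact: add_continuous.
Qed.

Lemma measurable_scalev r f : measurable_fun setT r -> measurable_fun setT f ->
  measurable_fun setT (fun x => (r x *: (f x : H)) : borel H).
Proof.
move=> /open_measurable_realP mr /open_measurable_borelP mf.
apply/open_measurable_borelP.
apply: (@continuous2_open_measurable R _ _ R^o H H (fun z => z.1 *: z.2)) => //.
  exact: separable_real.
exact: scale_continuous.
Qed.

Lemma measurable_oppv f : measurable_fun setT f ->
  measurable_fun setT (fun x => (- (f x : H)) : borel H).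
Proof. by apply: measurable_continuous; exact: oppr_continuous. Qed.

Lemma measurable_subv f g : measurable_fun setT f -> measurable_fun setT g ->
  measurable_fun setT (fun x => ((f x : H) - (g x : H)) : borel H).
Proof. by move=> mf mg; apply: measurable_addv => //; exact: measurable_oppv. Qed.

Lemma measurable_sumv I (s : seq I) (F : I -> D -> borel H) :
  (forall i, measurable_fun setT (F i)) ->
  measurable_fun setT (fun x => (\sum_(i <- s) (F i x : H)) : borel H).
Proof.
move=> mF; elim: s => [|i s ih].
  under eq_fun do rewrite big_nil; exact: measurable_cst.
under eq_fun do rewrite big_cons; exact: measurable_addv.
Qed.

Lemma measurable_invr r : measurable_fun setT r -> (forall x, 0 <= r x) ->
  measurable_fun setT (fun x => (r x)^-1).
Proof.
move=> mr r0.
rewrite (_ : (fun x => _) = (fun x => r x `^ (-1))).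
  exact: (measurableT_comp (measurable_powR (-1)) mr).
by apply/funext => x; rewrite powR_inv1.
Qed.

Lemma measurable_dir f : measurable_fun setT f ->
  measurable_fun setT (fun x => dir (f x : H) : borel H).
Proof.
move=> mf; apply: measurable_scalev => //; apply: measurable_invr => //.
exact: measurable_norm.
Qed.

Lemma measurable_inner (inner : {dot H for idfun}) f g : induces_norm inner ->
  measurable_fun setT f -> measurable_fun setT g ->
  measurable_fun setT (fun x => inner (f x : H) (g x : H)).
Proof.
move=> hilbertH mf mg.
rewrite (_ : (fun x => _) = fun x =>
    (`|(f x : H) + (g x : H)| ^+ 2 - `|f x : H| ^+ 2 - `|g x : H| ^+ 2) * 2^-1).
  apply: measurable_funM => //; apply: measurable_funB; [apply: measurable_funB|];
    apply: measurable_funX; apply: measurable_norm => //; exact: measurable_addv.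
by apply/funext => x; rewrite (normD_sqr hilbertH); field.
Qed.

End HilbertMeasurability.

(** * Bounded random variables and independence *)

Section BoundedIntegrals.
Context d (T : measurableType d) (R : realType) (P : probability T R).
Implicit Types (f g : T -> R) (r : R).

(** No measure is mentioned, so the same predicate, read over a smaller sigma-algebra on the same
    points, also expresses a bounded adapted variable. *)
Definition bounded_rv f := measurable_fun setT f /\ exists M, forall x, `|f x| <= M.

Lemma bounded_rv_integrable f : bounded_rv f -> P.-integrable setT (EFin \o f).
Proof.
move=> [mf [M fM]]; apply: measurable_bounded_integrable => //.
  by apply: le_lt_trans (ltry 1); exact: probability_le1.
exists M; split=> [|x Mx y _]; first exact: num_real.
by apply: le_trans (fM y) _; exact: ltW.
Qed.

Lemma bounded_rv_cst r : bounded_rv (cst r).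
Proof. by split=> //; exists `|r|. Qed.

Lemma bounded_rvD f g : bounded_rv f -> bounded_rv g -> bounded_rv (fun x => f x + g x).
Proof.
move=> [mf [M fM]] [mg [N gN]]; split; first exact: measurable_funD.
by exists (M + N) => x; apply: le_trans (ler_normD _ _) _; exact: lerD.
Qed.

Lemma bounded_rvM f g : bounded_rv f -> bounded_rv g -> bounded_rv (fun x => f x * g x).
Proof.
move=> [mf [M fM]] [mg [N gN]]; split; first exact: measurable_funM.
by exists (M * N) => x; rewrite normrM ler_pM.
Qed.

Lemma bounded_rvZ r f : bounded_rv f -> bounded_rv (fun x => r * f x).
Proof. by apply: bounded_rvM; exact: bounded_rv_cst. Qed.

Lemma bounded_rvN f : bounded_rv f -> bounded_rv (fun x => - f x).
Proof.
move=> [mf [M fM]]; split; first exact: measurable_funN.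
by exists M => x; rewrite normrN.
Qed.

Lemma bounded_rvB f g : bounded_rv f -> bounded_rv g -> bounded_rv (fun x => f x - g x).
Proof. by move=> bf bg; apply: bounded_rvD => //; exact: bounded_rvN. Qed.

Lemma bounded_rvX f n : bounded_rv f -> bounded_rv (fun x => f x ^+ n).
Proof.
move=> [mf [M fM]]; split; first exact: measurable_funX.
by exists (M ^+ n) => x; rewrite normrX lerXn2r ?nnegrE// (le_trans _ (fM x)).
Qed.

Lemma bounded_rv_sum I (s : seq I) (F : I -> T -> R) : (forall i, bounded_rv (F i)) ->
  bounded_rv (fun x => \sum_(i <- s) F i x).
Proof.
move=> bF; elim: s => [|i s ih].
  by under eq_fun do rewrite big_nil; exact: bounded_rv_cst.
by under eq_fun do rewrite big_cons; exact: bounded_rvD.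
Qed.

Local Notation "''E' f" := (Rintegral P setT f) (at level 10, f at level 9).

Lemma ERD f g : bounded_rv f -> bounded_rv g -> 'E (fun x => f x + g x) = 'E f + 'E g.
Proof. by move=> bf bg; rewrite RintegralD//; exact: bounded_rv_integrable. Qed.

Lemma ERB f g : bounded_rv f -> bounded_rv g -> 'E (fun x => f x - g x) = 'E f - 'E g.
Proof. by move=> bf bg; rewrite RintegralB//; exact: bounded_rv_integrable. Qed.

Lemma ERZ r f : bounded_rv f -> 'E (fun x => r * f x) = r * 'E f.
Proof. by move=> bf; rewrite RintegralZl//; exact: bounded_rv_integrable. Qed.

Lemma ER_cst r : 'E (cst r) = r.
Proof.
rewrite Rintegral_cst// -[RHS]mulr1; congr (_ * _).
by rewrite -[RHS]/(fine 1%:E); congr fine; exact: probability_setT.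
Qed.

Lemma ler_ER f g : bounded_rv f -> bounded_rv g -> (forall x, f x <= g x) -> 'E f <= 'E g.
Proof. by move=> bf bg fg; apply: le_Rintegral => //; exact: bounded_rv_integrable. Qed.

Lemma ER_ge0 f : (forall x, 0 <= f x) -> 0 <= 'E f.
Proof. by move=> f0; exact: Rintegral_ge0. Qed.

Lemma ER_sum I (s : seq I) (F : I -> T -> R) : (forall i, bounded_rv (F i)) ->
  'E (fun x => \sum_(i <- s) F i x) = \sum_(i <- s) 'E (F i).
Proof.
move=> bF; elim: s => [|i s ih].
  by under eq_fun do rewrite big_nil; rewrite big_nil; exact: ER_cst.
under eq_fun do rewrite big_cons.
by rewrite big_cons ERD// ?ih//; exact: bounded_rv_sum.
Qed.

End BoundedIntegrals.

(** * Independence: integrating out one variable against its law *)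

Section Freezing.
Context d (T : measurableType d) (R : realType) (P : probability T R).
Context d' (E : measurableType d') (Y : {RV P >-> E}).
Context (G : set (set T)) (Gm : G `<=` measurable) (GT : G setT).
Context (GI : setI_closed G).
Context (indep : forall A B, G A -> measurable B ->
  P (A `&` Y @^-1` B) = (P A * P (Y @^-1` B))%E).

(** For fixed [B] both sides are finite measures in [A] that agree on the pi-system [G]; uniqueness
    of measures extends the equality. *)
Lemma independent_generated A B : <<s G >> A -> measurable B ->
  P (A `&` Y @^-1` B) = (P A * P (Y @^-1` B))%E.
Proof.
move=> sA mB.
have mYB : measurable (Y @^-1` B) by rewrite -[_ @^-1` _]setTI; exact: measurable_funP.
have fYB : P (Y @^-1` B) \is a fin_num by exact: fin_num_measure.
pose c : {nonneg R} := NngNum (fine_ge0 (measure_ge0 P (Y @^-1` B))).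
have /(_ (fun=> setT)) H := @g_sigma_algebra_measure_unique _ R T G Gm.
have := H (fun=> GT) _ (mrestr P mYB) (mscale c P) GI _ _ A sA.
rewrite /= /mrestr /mscale /= => ->.
- by rewrite fineK// muleC.
- by apply/seteqP; split=> // x _; exists 0%N.
- by move=> C GC; rewrite /mrestr /mscale /= fineK// indep// muleC.
- by move=> _; rewrite setTI ltey_eq fYB.
Qed.

Let T' := g_sigma_algebraType G.

Lemma generated_measurable (A : set T) : <<s G >> A -> measurable A.
Proof. by apply: smallest_sub => //; exact: sigma_algebra_measurable. Qed.

Lemma measurable_fun_generated d2 (E2 : measurableType d2) (f : T' -> E2) :
  measurable_fun setT f -> measurable_fun setT (f : T -> E2).
Proof.
move=> mf _ B mB; rewrite setTI; apply: generated_measurable.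
by have := mf measurableT B mB; rewrite setTI.
Qed.

(* Given the information in G, the variable Y is integrated out against its
   law while the G-measurable arguments are kept fixed. *)
Lemma integral_freezing (f : T' * E -> R) : bounded_rv f ->
  Rintegral P setT (fun w => f (w, Y w))
  = Rintegral P setT (fun w => Rintegral (distribution P Y) setT (fun y => f (w, y))).
Proof.
move=> bf.
(* The law of the identity into [T'] is the restriction of [P] to the sigma-algebra generated by
   [G]. *)
have mid : measurable_fun setT (id : T -> T').
  by move=> _ B mB; rewrite setTI; exact: generated_measurable.
pose idm : {mfun T >-> T'} := HB.pack (id : T -> T') (isMeasurableFun.Build _ _ _ _ _ mid).
have mY : measurable_fun setT Y by [].
have mphi : measurable_fun setT ((fun w => (w, Y w)) : T -> T' * E).
  by apply: measurable_fun_pair.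
pose phi : {mfun T >-> (T' * E)%type} :=
  HB.pack ((fun w => (w, Y w)) : T -> (T' * E)%type) (isMeasurableFun.Build _ _ _ _ _ mphi).
pose P' : probability T' R := distribution P idm.
pose nu : probability E R := distribution P Y.
(* Independence says that the joint law of the past and of [Y] is a product measure; the rest is
   Fubini and two changes of variables. *)
have prodE : forall X, measurable X -> (P' \x nu)%E X = distribution P phi X.
  apply: product_measure_unique => A B mA mB.
  by rewrite -independent_generated.
have intf : (P' \x nu)%E.-integrable setT (EFin \o f).
  apply: measurable_bounded_integrable => //; last 2 first.
  - exact: bf.1.
  - case: bf => _ [M fM]; exists M; split=> [|x Mx y _]; first exact: num_real.
    by apply: le_trans (fM y) _; exact: ltW.
  have e : ((P' \x nu) setT <= 1)%E.
    by rewrite prodE//; exact: (probability_le1 (distribution P phi)).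
  exact: le_lt_trans e (ltry 1).
have slice w : bounded_rv (fun y => f (w, y)).
  split; last by case: bf => _ [M fM]; exists M.
  exact: measurable_fun_pair2 bf.1.
have FE w : fubini_F nu (EFin \o f) w = (Rintegral nu setT (fun y => f (w, y)))%:E.
  rewrite /fubini_F /Rintegral fineK//.
  by apply: integrable_fin_num => //; exact: bounded_rv_integrable.
have mF : measurable_fun setT (fubini_F nu (EFin \o f)).
  exact: (measurable_fubini_F intf).
rewrite /Rintegral; congr fine.
transitivity (\int[distribution P phi]_z (EFin \o f) z)%E.
  apply/esym; apply: integral_distribution; first by apply/measurable_EFinP; exact: bf.1.
  apply: (@bounded_rv_integrable _ _ _ P (fun w => f (w, Y w))); split.
    exact: (measurableT_comp bf.1 mphi).
  by case: bf => _ [M fM]; exists M.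
rewrite -(@eq_measure_integral _ _ _ setT (distribution P phi) (P' \x nu)%E); last first.
  by move=> A mA _; exact: prodE.
rewrite -integral12_prod_meas1//.
apply/esym; transitivity (\int[P]_w (fubini_F nu (EFin \o f) \o idm) w)%E.
  by apply: eq_integral => w _ /=; rewrite FE.
apply/esym; apply: integral_distribution => //.
rewrite (_ : _ \o _ = EFin \o (fun w => Rintegral nu setT (fun y => f (w, y)))); last first.
  by apply/funext => w /=; rewrite FE.
apply: bounded_rv_integrable; split.
  apply: measurable_fun_generated; apply/measurable_EFinP.
  by rewrite (_ : _ \o _ = fubini_F nu (EFin \o f))//; apply/funext => w /=; rewrite FE.
case: bf => mf [M fM]; exists M => w.
have h := le_normr_Rintegral measurableT (@bounded_rv_integrable _ _ _ nu _ (slice w)).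
apply: le_trans h _.
rewrite -[leRHS](ER_cst nu); apply: ler_ER => //; last exact: bounded_rv_cst.
by split; [apply: measurableT_comp => //; case: (slice w)|exists M => x; rewrite normr_id].
Qed.

End Freezing.

(** * The gradient of the objective and its coercivity *)

Section InverseMoments.
Context d (T : measurableType d) (R : realType) (P : probability T R).
Implicit Types (f g r : T -> R).

Lemma integrable_scale (c : R) f : P.-integrable setT (EFin \o f) ->
  P.-integrable setT (EFin \o (fun x => c * f x)).
Proof. by move=> intf; exact: (integrableZl measurableT c intf). Qed.

Lemma integrable_diff f g : P.-integrable setT (EFin \o f) ->
  P.-integrable setT (EFin \o g) -> P.-integrable setT (EFin \o (fun x => f x - g x)).
Proof. by move=> intf intg; exact: (integrableB measurableT intf intg). Qed.

Lemma ae_ler_Rintegral f g :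
  P.-integrable setT (EFin \o f) -> P.-integrable setT (EFin \o g) ->
  {ae P, forall x, f x <= g x} -> Rintegral P setT f <= Rintegral P setT g.
Proof.
move=> intf intg fg; rewrite -subr_ge0 -RintegralB//.
have mf : measurable_fun setT f by apply/measurable_EFinP; exact: measurable_int intf.
have mg : measurable_fun setT g by apply/measurable_EFinP; exact: measurable_int intg.
have mB : measurable_fun setT (fun x => g x - f x) by exact: measurable_funB.
(* The absolute value agrees with the integrand almost everywhere and is nonnegative at every
   point. *)
rewrite /Rintegral (@ae_eq_integral _ _ _ _ _ (fun x => `|g x - f x|%:E)).
- by apply: fine_ge0; apply: integral_ge0 => x _; rewrite lee_fin.
- by [].
- exact/measurable_EFinP.
- by apply/measurable_EFinP; exact: measurableT_comp.
- by apply: filterS fg => x fgx _; rewrite ger0_norm// subr_ge0.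
Qed.

(** The extended inverse is +oo at 0, so a finite integral forces [r] to be nonzero almost
    everywhere; the real inverse, which is 0 there, then has the same integral. *)
Lemma finite_inverse_moment r (C : R) : measurable_fun setT r ->
    (forall x, 0 <= r x) -> (\int[P]_x ((r x)%:E)^-1 <= C%:E)%E ->
  [/\ P.-integrable setT (EFin \o (fun x => (r x)^-1)),
      Rintegral P setT (fun x => (r x)^-1) <= C &
      {ae P, forall x, r x != 0}].
Proof.
move=> mr r0 rC.
have mV : measurable_fun setT (fun x => ((r x)%:E)^-1%E).
  rewrite (_ : (fun x => _) = fun x => if r x == 0 then +oo%E else ((r x)^-1)%:E); last first.
    by apply/funext => x; rewrite inver.
  apply: measurable_fun_ifT => //; first exact: measurable_fun_eqr.
  by apply/measurable_EFinP; exact: measurable_invr.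
have intV : P.-integrable setT (fun x => ((r x)%:E)^-1%E).
  apply/integrableP; split => //.
  under eq_integral do rewrite gee0_abs ?inve_ge0 ?lee_fin//.
  exact: le_lt_trans rC (ltry _).
have ae0 : {ae P, forall x, r x != 0}.
  apply: filterS (integrable_ae measurableT intV) => x /(_ I).
  by rewrite inver; case: eqP.
have mrV : measurable_fun setT (fun x => ((r x)^-1)%:E).
  by apply/measurable_EFinP; exact: measurable_invr.
have intE : (\int[P]_x ((r x)^-1)%:E = \int[P]_x ((r x)%:E)^-1)%E.
  apply: ae_eq_integral => //; apply: filterS ae0 => x /negbTE rx _.
  by rewrite inver rx.
have intr : P.-integrable setT (EFin \o (fun x => (r x)^-1)).
  apply/integrableP; split => //.
  under eq_integral do rewrite /= ger0_norm ?invr_ge0//.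
  by rewrite intE; exact: le_lt_trans rC (ltry _).
split=> //; rewrite -lee_fin /Rintegral fineK ?intE//.
by rewrite -intE; exact: integrable_fin_num.
Qed.

End InverseMoments.

(** * The gradient field of the objective and its zero at the median *)

Section GeometricMedian.
Context (R : realType) (H : completeNormedModType R) (inner : {dot H for idfun}).
Context (hilbertH : induces_norm inner) (separableH : separable H).
Context d (T : measurableType d) (P : probability T R).
Context (X : {RV P >-> borel H}).
Local Notation "''[' u , v ]" := (inner u v).
Local Notation "''E' f" := (Rintegral P setT f) (at level 10, f at level 9).
Implicit Types (u v w h : H).

Let mX : measurable_fun setT (X : T -> borel H). Proof. exact: measurable_funP. Qed.

Lemma measurable_dist h : measurable_fun setT (fun x => `|h - (X x : H)|).
Proof. by apply: measurable_norm => //; apply: measurable_subv => //; exact: measurable_cst. Qed.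

Lemma measurable_dir_dist h : measurable_fun setT (fun x => dir (h - (X x : H)) : borel H).
Proof. by apply: measurable_dir => //; apply: measurable_subv => //; exact: measurable_cst. Qed.

Lemma bounded_inner_dir u h : bounded_rv (fun x => '[u, dir (h - X x)]).
Proof.
split; first by apply: measurable_inner => //; exact: measurable_dir_dist.
exists `|u| => x; apply: le_trans (cauchy_schwarz hilbertH _ _) _.
by rewrite -[leRHS]mulr1 ler_wpM2l// norm_dir_le1.
Qed.

(** The expectation of the random vector [dir (h - X)] is taken weakly: its pairings with [u] form a
    linear functional of norm at most 1. *)
Lemma gradient_exists h : exists g : H, forall u, '[u, g] = 'E (fun x => '[u, dir (h - X x)]).
Proof.
apply: (riesz_representation hilbertH (K := 1)) => [u v|r u|u].
- under eq_Rintegral do rewrite (innerDl inner).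
  by rewrite (ERD P (bounded_inner_dir _ _) (bounded_inner_dir _ _)).
- under eq_Rintegral do rewrite (innerZl inner).
  by rewrite (ERZ P _ (bounded_inner_dir _ _)).
have bu := bounded_inner_dir u h.
apply: le_trans (le_normr_Rintegral measurableT (bounded_rv_integrable P bu)) _.
rewrite mul1r -[leRHS](ER_cst P); apply: ler_ER => [||x]; last 1 first.
- apply: le_trans (cauchy_schwarz hilbertH _ _) _.
  by rewrite -[leRHS]mulr1 ler_wpM2l// norm_dir_le1.
- split; first by apply: measurableT_comp => //; exact: bu.1.
  by case: bu => _ [M uM]; exists M => x; rewrite normr_id.
- exact: bounded_rv_cst.
Qed.

Definition gradient h : H := sval (cid (gradient_exists h)).

Lemma gradientE u h : '[u, gradient h] = 'E (fun x => '[u, dir (h - X x)]).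
Proof. exact: (svalP (cid (gradient_exists h))). Qed.

Lemma norm_gradient h : `|gradient h| <= 1.
Proof.
have [->|g0] := eqVneq (gradient h) 0; first by rewrite normr0.
have G0 : 0 < `|gradient h| by rewrite normr_gt0.
rewrite -(ler_pM2r G0) mul1r -expr2 -(innerxx hilbertH) gradientE.
rewrite -[leRHS](ER_cst P); apply: ler_ER => [||x]; first exact: bounded_inner_dir.
  exact: bounded_rv_cst.
apply: le_trans (inner_le hilbertH _ _) _.
by rewrite -[leRHS]mulr1 ler_wpM2l// norm_dir_le1.
Qed.

Context (A2 : bounded_inverse_moments P X).

Lemma inverse_moments : exists2 C : R, 0 < C & forall h,
  [/\ P.-integrable setT (EFin \o (fun x => `|h - X x|^-1)),
      P.-integrable setT (EFin \o (fun x => (`|h - X x| ^+ 2)^-1)),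
      'E (fun x => `|h - X x|^-1) <= C,
      'E (fun x => (`|h - X x| ^+ 2)^-1) <= C &
      {ae P, forall x, h - X x != 0}].
Proof.
case: A2 => C C0 AC; exists C => // h; have [A1 A22] := AC h.
have [|//||i1 e1 a1] := @finite_inverse_moment _ _ _ P (fun x => `|h - X x|) C.
- exact: measurable_dist.
- by under eq_integral do rewrite distrC.
have [|//||i2 e2 a2] := @finite_inverse_moment _ _ _ P (fun x => `|h - X x| ^+ 2) C.
- by apply: measurable_funX; exact: measurable_dist.
- by under eq_integral do rewrite distrC.
by split=> //; apply: filterS a1 => x; rewrite normr_eq0.
Qed.

(** The gradient difference is paired with itself and [dir_lipschitz] is integrated; the constant is
    uniform because the bound in (A2) does not depend on the point. *)
Lemma gradient_lipschitz : exists2 C : R, 0 < C &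
  forall h h', `|gradient h - gradient h'| <= C * `|h - h'|.
Proof.
have [C C0 hC] := inverse_moments; exists (2 * C); first by rewrite mulr_gt0.
move=> h h'; set g := gradient h - gradient h'.
have [->|g0] := eqVneq g 0; first by rewrite normr0 !mulr_ge0// ltW.
have G0 : 0 < `|g| by rewrite normr_gt0.
rewrite -(ler_pM2r G0) -expr2 -(innerxx hilbertH) {2}/g (innerBr inner) !gradientE.
rewrite -(ERB P (bounded_inner_dir _ _) (bounded_inner_dir _ _)).
have [i1 i2 e1 e2 ae0] := hC h'.
apply: (@le_trans _ _ ('E (fun x => (2 * `|h - h'| * `|g|) * `|h' - X x|^-1))).
  apply: ae_ler_Rintegral.
  - by apply: bounded_rv_integrable; apply: bounded_rvB; exact: bounded_inner_dir.
  - exact: integrable_scale.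
  apply: filterS ae0 => x hx; rewrite -(innerBr inner).
  apply: le_trans (inner_le hilbertH _ _) _.
  rewrite mulrAC [leRHS]mulrC ler_wpM2l//.
  apply: le_trans (dir_lipschitz _ hx) _.
  by rewrite [X in `|X|](_ : _ = h - h')// opprB addrA subrK.
rewrite RintegralZl// (_ : 2 * C * `|h - h'| * `|g| = 2 * `|h - h'| * `|g| * C); last by ring.
by rewrite ler_wpM2l// !mulr_ge0.
Qed.

Lemma continuous_gradient : continuous gradient.
Proof.
have [C C0 gC] := gradient_lipschitz => h.
apply/cvgrPdist_lt => e e0; have eC0 : 0 < e / C by rewrite divr_gt0.
near=> h'; apply: le_lt_trans (gC _ _) _.
by rewrite mulrC -ltr_pdivlMr.
Unshelve. all: by end_near. Qed.

Section Median.
Context (m : H) (median_m : geometric_median P X m).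

Let bounded_norm_diff h h' : bounded_rv (fun x => `|X x - h| - `|X x - h'|).
Proof.
split; last first.
  exists `|h' - h| => x; apply: le_trans (ler_dist_dist _ _) _.
  by rewrite opprB addrC addrA subrK.
apply: measurable_funB; (apply: measurable_norm => //; apply: measurable_subv => //; exact: measurable_cst).
Qed.

(** Convexity of the norm: [|h - X| - |m - X|] is at most ['[h - m, dir (h - X)]]. Its expectation
    is nonnegative by minimality of [m]. *)
Lemma gradient_median_ge0 h : 0 <= '[h - m, gradient h].
Proof.
have bn h' : bounded_rv (fun x => `|X x - h'| - `|X x|).
  by have := bounded_norm_diff h' 0; under [X in bounded_rv X -> _]eq_fun do rewrite subr0.
have e h' : ('E_P[fun x => (`|X x - h'| - `|X x|)%R] = ('E (fun x => `|X x - h'| - `|X x|))%:E)%E.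
  rewrite unlock /Rintegral fineK//.
  by apply: integrable_fin_num => //; exact: bounded_rv_integrable.
have := median_m h; rewrite !e lee_fin -subr_ge0 -(ERB P (bn _) (bn _)) => /le_trans; apply.
rewrite gradientE; apply: ler_ER => [||x]; first exact: bounded_rvB.
  exact: bounded_inner_dir.
have -> : `|X x - h| - `|X x| - (`|X x - m| - `|X x|) = `|h - X x| - `|m - X x|.
  by rewrite (distrC h) (distrC m); ring.
have hE : '[h - X x, dir (h - X x)] = `|h - X x|.
  rewrite -{1}(norm_dirK (h - X x)) (innerZl inner) (innerxx hilbertH).
  have [->|h0] := eqVneq (h - X x) 0; first by rewrite normr0 mul0r.
  by rewrite norm_dir// expr1n mulr1.
rewrite -{1}hE (_ : h - m = (h - X x) - (m - X x)); last by rewrite opprB addrA subrK.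
rewrite (innerBl inner _ (m - X x)) lerD2l lerN2.
apply: le_trans (inner_le hilbertH _ _) _.
by rewrite -[leRHS]mulr1 ler_wpM2l// norm_dir_le1.
Qed.

(** The objective is not differentiated. If [g] were nonzero, a short move from [m] along [- g]
    would keep the gradient correlated with [g], against [gradient_median_ge0]. *)
Lemma gradient_median : gradient m = 0.
Proof.
have [C C0 gC] := gradient_lipschitz.
set g := gradient m; apply/eqP; apply: contraT => g0.
have G0 : 0 < `|g| by rewrite normr_gt0.
(* With this length the Lipschitz bound lets the gradient lose at most half of its component along
   [g]. *)
pose t := (2 * C)^-1; have t0 : 0 < t by rewrite invr_gt0 mulr_gt0.
have := gradient_median_ge0 (m - t *: g).
rewrite {1}(_ : m - t *: g - m = (- t) *: g); last by rewrite addrAC subrr add0r scaleNr.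
rewrite (innerZl inner) mulNr oppr_ge0 pmulr_rle0// => h1.
have h2 : '[g, g - gradient (m - t *: g)] <= `|g| * (C * (t * `|g|)).
  apply: le_trans (inner_le hilbertH _ _) _; rewrite ler_wpM2l//.
  apply: le_trans (gC _ _) _.
  by rewrite opprB addrCA subrr addr0 normrZ gtr0_norm.
move: h2; rewrite (innerBr inner) (innerxx hilbertH).
have -> : `|g| * (C * (t * `|g|)) = `|g| ^+ 2 / 2 by rewrite /t; field; rewrite gt_eqF.
have : 0 < `|g| ^+ 2 by rewrite exprn_gt0.
by lra.
Qed.

End Median.
End GeometricMedian.

Section NonnegativeIntegrals.
Context d (T : measurableType d) (R : realType) (P : probability T R).

Lemma ae_eq0_Rintegral (f : T -> R) : bounded_rv f -> (forall x, 0 <= f x) ->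
  Rintegral P setT f <= 0 -> {ae P, forall x, f x = 0}.
Proof.
move=> bf f0 If0.
have mf : measurable_fun setT (EFin \o f) by apply/measurable_EFinP; exact: bf.1.
have : (\int[P]_x `|(EFin \o f) x| = 0)%E.
  under eq_integral do rewrite /= ger0_norm//.
  apply/eqP; rewrite eq_le integral_ge0 ?andbT; last by move=> x _; rewrite lee_fin.
  rewrite -[leLHS]fineK; last by apply: integrable_fin_num => //; exact: bounded_rv_integrable.
  by rewrite lee_fin.
move=> /(ae_eq_integral_abs P measurableT mf); apply: filterS => x /(_ I) /= [].
by [].
Qed.

Lemma ae_False : ~ {ae P, forall x, False}.
Proof.
move=> [N [mN N0 sN]].
have : (P setT <= P N)%E.
  by apply: le_measure; rewrite ?inE// => x _; apply: sN.
by rewrite N0 (_ : P setT = 1%E) ?lee_fin ?ler10//; exact: probability_setT.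
Qed.

Lemma variance_ae_cst (Y : T -> R) (c : R) : measurable_fun setT Y ->
  {ae P, forall x, Y x = c} -> ('V_P[Y] = 0)%E.
Proof.
move=> mY Yc.
have EY : ('E_P[Y] = c%:E)%E.
  rewrite unlock (@ae_eq_integral _ _ _ _ _ (cst c%:E))//.
  - rewrite integral_cst// -[RHS]mule1; congr (_ * _)%E; exact: probability_setT.
  - exact/measurable_EFinP.
  - by apply: filterS Yc => x -> _.
rewrite /variance unlock EY /= unlock (@ae_eq_integral _ _ _ _ _ (cst 0%E))//.
- by rewrite integral_cst// mul0e.
- by apply/measurable_EFinP; apply: measurable_funM; apply: measurable_funB.
- apply: filterS Yc => x Yx _.
  by change (((Y x - c) * (Y x - c))%:E = 0%E); rewrite Yx subrr mulr0.
Qed.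

End NonnegativeIntegrals.

(** * Uniform coercivity of the averaged Cauchy-Schwarz defect *)

Section DirectionBound.
Context (R : realType) (H : completeNormedModType R) (inner : {dot H for idfun}).
Context (hilbertH : induces_norm inner).
Local Notation "''[' u , v ]" := (inner u v).

Lemma inner_dir_sqr_le (v b : H) : '[v, dir b] ^+ 2 <= `|v| ^+ 2.
Proof.
rewrite -[leLHS]real_normK ?num_real// ler_pXn2r ?nnegrE//.
apply: le_trans (cauchy_schwarz hilbertH _ _) _.
by rewrite -[leRHS]mulr1 ler_wpM2l// norm_dir_le1.
Qed.

(** The factor [|a|] of [inner_dir_monotone] is at most [(1 + |b|) * (1 + |a - b|)]. With
    [a = h - X] and [b = m - X] this separates the random distance from the deterministic one,
    [|h - m|]. *)
Lemma inner_dir_coercive (a b : H) :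
  (1 + `|b|)^-1 * (`|a - b| ^+ 2 - '[a - b, dir b] ^+ 2) / (2 * (1 + `|a - b|))
  <= '[a - b, dir a - dir b].
Proof.
have B1 : 0 < 1 + `|b| by rewrite ltr_wpDr.
have W1 : 0 < 1 + `|a - b| by rewrite ltr_wpDr.
rewrite ler_pdivrMr ?mulr_gt0// mulrC ler_pdivrMr//.
have inner_dir (v : H) : '[v, dir v] = `|v|.
  rewrite -{1}(norm_dirK v) (innerZl inner) (innerxx hilbertH).
  have [->|v0] := eqVneq v 0; first by rewrite normr0 mul0r.
  by rewrite norm_dir// expr1n mulr1.
have [a0|a0] := eqVneq a 0.
  have e1 : '[- b, dir b] = - `|b| by rewrite -scaleN1r (innerZl inner) inner_dir mulN1r.
  rewrite a0 dir0 !sub0r -dirN inner_dir e1 normrN sqrrN subrr.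
  by rewrite !mulr_ge0// ltW.
have [b0|b0] := eqVneq b 0.
  rewrite b0 dir0 !subr0 inner_dir.
  rewrite normr0 addr0 mulr1 -(scale0r (0 : H)) (innerZr inner) mul0r expr0n subr0.
  by have := normr_ge0 a; nra.
have := inner_dir_monotone hilbertH a0 b0; move=> /le_trans; apply.
have ab : `|a| <= `|b| + `|a - b|.
  by rewrite -{1}(subrK b a) addrC ler_normD.
have D0 : 0 <= '[a - b, dir a - dir b].
  have h := inner_dir_monotone hilbertH a0 b0.
  have A0 : 0 < 2 * `|a| by rewrite mulr_gt0// normr_gt0.
  by rewrite -(pmulr_rge0 _ A0) (le_trans _ h)// subr_ge0 inner_dir_sqr_le.
have := normr_ge0 b; have := normr_ge0 (a - b).
move: ab D0; move: `|a| `|b| `|a - b| '[_, _] => A B W D ab D0 W0 B0.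
have : A * D <= (1 + B) * (1 + W) * D by apply: ler_wpM2r => //; nra.
by lra.
Qed.

Lemma one_sub_inner_dir_triangle (b e f : H) : `|e| = 1 -> `|f| = 1 ->
  1 - '[f, dir b] ^+ 2 <= 2 * (1 - '[e, dir b] ^+ 2) + 2 * (1 - '[e, f] ^+ 2).
Proof.
move=> e1 f1; have := sin_sqr_triangle hilbertH (norm_dir_le1 b) e1 f1.
rewrite !(innerC inner (dir b)).
have : `|dir b| ^+ 2 <= 1 by rewrite exprn_ile1// norm_dir_le1.
by lra.
Qed.

End DirectionBound.

Section Coercivity.
Context (R : realType) (H : completeNormedModType R) (inner : {dot H for idfun}).
Context (hilbertH : induces_norm inner) (separableH : separable H).
Context d (T : measurableType d) (P : probability T R).
Context (X : {RV P >-> borel H}).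
Local Notation "''[' u , v ]" := (inner u v).
Local Notation "''E' f" := (Rintegral P setT f) (at level 10, f at level 9).
Implicit Types (e f u v w h : H) (x : T).
Context (A1 : nondegenerate_orthogonally P inner X).
Context (A2 : bounded_inverse_moments P X).
Context (m : H).

(** The random factor left by [inner_dir_coercive]. It keeps [spread v] below [|v| ^+ 2] whatever
    the tail of [X], and it is also below the inverse distance that appears in the second
    derivative. *)
Definition weight x : R := (1 + `|m - X x|)^-1.
Definition spread v x : R := weight x * (`|v| ^+ 2 - '[v, dir (m - X x)] ^+ 2).

Lemma weight_gt0 x : 0 < weight x. Proof. by rewrite invr_gt0 ltr_wpDr. Qed.

#[local] Hint Resolve weight_gt0 : core.

Lemma weight_le1 x : weight x <= 1.
Proof. by rewrite invf_le1 ?ltr_wpDr// lerDl. Qed.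

Lemma bounded_weight : bounded_rv weight.
Proof.
split; last by exists 1 => x; rewrite ger0_norm ?weight_le1// ltW.
apply: measurable_invr => [|x]; last by rewrite addr_ge0.
by apply: measurable_funD => //; exact: measurable_dist.
Qed.

#[local] Hint Resolve bounded_weight : core.

Lemma bounded_spread v : bounded_rv (spread v).
Proof.
apply: bounded_rvM => //; apply: bounded_rvB; first exact: bounded_rv_cst.
by apply: bounded_rvX; exact: bounded_inner_dir.
Qed.

#[local] Hint Resolve bounded_spread : core.

Lemma spread_ge0 v x : 0 <= spread v x.
Proof. by rewrite mulr_ge0 ?(ltW (weight_gt0 x))// subr_ge0 inner_dir_sqr_le. Qed.

#[local] Hint Resolve weight_le1 spread_ge0 : core.

Let Q v := 'E (spread v).

(** If [Q f] vanished, [X] would almost surely lie on the line through [m] directed by [f], and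
    ['[X, h']] would be constant for every [h'] orthogonal to [f], against (A1). *)
Let Q_gt0 f : `|f| = 1 -> 0 < Q f.
Proof.
move=> f1; rewrite ltNge; apply/negP => Qf.
have [h' fh' V0] := A1 f.
move: V0; rewrite (@variance_ae_cst _ _ _ P _ '[m, h']) ?ltxx//.
  by apply: measurable_inner => //; exact: measurable_cst.
have := ae_eq0_Rintegral (bounded_spread f) (spread_ge0 f) Qf.
apply: filterS => x; rewrite /spread.
have uX := norm_dirK (m - X x); have u1 := norm_dir_le1 (m - X x).
move: (dir (m - X x)) uX u1 => u uX u1.
move=> /eqP; rewrite mulf_eq0 gt_eqF//= f1 expr1n subr_eq0 => /eqP fu.
have uE : u = '[f, u] *: f.
  apply/eqP; rewrite -subr_eq0 -normr_eq0 -sqrf_eq0 eq_le sqr_ge0 andbT.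
  rewrite (normB_sqr hilbertH) (innerZr inner) normrZ f1 mulr1 real_normK ?num_real//.
  rewrite (innerC inner u f) -expr2 -fu.
  have : `|u| ^+ 2 <= 1 by rewrite exprn_ile1.
  by lra.
have : '[m - X x, h'] = 0.
  rewrite -uX (innerZl inner) uE (innerZl inner) fh'.
  by rewrite !mulr0.
by rewrite (innerBl inner) => /subr0_eq.
Qed.

Let Q_lip v v' : `|Q v - Q v'| <= 2 * (`|v| + `|v'|) * `|v - v'|.
Proof.
rewrite /Q -(ERB P (bounded_spread v) (bounded_spread v')).
have bB := bounded_rvB (bounded_spread v) (bounded_spread v').
apply: le_trans (le_normr_Rintegral measurableT (bounded_rv_integrable P bB)) _.
rewrite -[leRHS](ER_cst P); apply: ler_ER => [||x]; last 1 first.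
- rewrite /spread -mulrBr normrM ger0_norm ?(ltW (weight_gt0 x))//.
  rewrite -[leRHS]mul1r ler_pM ?(ltW (weight_gt0 x))//.
  set u := dir _.
  have -> : `|v| ^+ 2 - '[v, u] ^+ 2 - (`|v'| ^+ 2 - '[v', u] ^+ 2) =
    (`|v| - `|v'|) * (`|v| + `|v'|) - '[v - v', u] * '[v + v', u].
    by rewrite !(innerE inner); ring.
  rewrite (_ : 2 * (`|v| + `|v'|) * `|v - v'| =
    `|v - v'| * (`|v| + `|v'|) + `|v - v'| * (`|v| + `|v'|)); last by ring.
  apply: le_trans (ler_normB _ _) _; rewrite !normrM; apply: lerD; apply: ler_pM => //.
  + exact: ler_dist_dist.
  + by rewrite ger0_norm// addr_ge0.
  + apply: le_trans (cauchy_schwarz hilbertH _ _) _.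
    by rewrite -[leRHS]mulr1 ler_wpM2l// norm_dir_le1.
  + apply: le_trans (cauchy_schwarz hilbertH _ _) _.
    apply: le_trans (ler_normD v v').
    by rewrite -[leRHS]mulr1 ler_wpM2l// norm_dir_le1.
- split; first by apply: measurableT_comp => //; exact: bB.1.
  by case: bB => _ [M uM]; exists M => x; rewrite normr_id.
- exact: bounded_rv_cst.
Qed.

(** Makes [Q] measurable when evaluated at the random direction of [m - X]. *)
Let continuous_Q : continuous Q.
Proof.
move=> v; apply/cvgrPdist_lt => e e0.
pose c := 2 * (2 * `|v| + 1).
have c0 : 0 < c by rewrite mulr_gt0// ltr_wpDl// mulr_ge0.
have ec0 : 0 < e / c by rewrite divr_gt0.
near=> v'; apply: le_lt_trans (Q_lip _ _) _.
have h1 : `|v - v'| < 1 by near: v'; exact: cvgr_dist_lt.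
have h2 : `|v - v'| < e / c by near: v'; exact: cvgr_dist_lt.
have h3 : `|v'| <= `|v| + `|v - v'|.
  by rewrite -{1}(subKr v v') ler_normB.
rewrite ltr_pdivlMr// in h2; apply: le_lt_trans h2.
rewrite mulrC ler_wpM2l// /c ler_wpM2l//; lra.
Unshelve. all: by end_near. Qed.

Let QZ r v : Q (r *: v) = r ^+ 2 * Q v.
Proof.
rewrite /Q -(ERZ P _ (bounded_spread v)); apply: eq_Rintegral => x _.
rewrite /spread (innerZl inner) normrZ exprMn real_normK ?num_real//; ring.
Qed.

Let Q_ge0 v : 0 <= Q v. Proof. exact: ER_ge0. Qed.

Let bounded_Q_dir : bounded_rv (fun x => weight x * Q (dir (m - X x))).
Proof.
apply: bounded_rvM => //; split.
  by apply: measurable_continuous_real => //; exact: measurable_dir_dist.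
exists 1 => x; rewrite ger0_norm//.
rewrite -[leRHS](ER_cst P); apply: ler_ER => [||y]; first exact: bounded_spread.
  exact: bounded_rv_cst.
rewrite -[leRHS]mul1r ler_pM ?(ltW (weight_gt0 _))// ?subr_ge0 ?inner_dir_sqr_le//.
apply: (@le_trans _ _ (`|dir (m - X x)| ^+ 2)); first by rewrite gerBl sqr_ge0.
by rewrite exprn_ile1// norm_dir_le1.
Qed.

(* Averaging the triangle inequality for the directions e, u(x), u(y) over y
   bounds Q(u(x)); averaging over x then bounds Q(e) below uniformly in e. *)
Lemma spread_coercive : exists2 c : R, 0 < c & forall v, c * `|v| ^+ 2 <= 'E (spread v).
Proof.
(* Of the divisor 4, one half comes from [2 * Q e] left by the average over y, the other from the
   sine between [e] and u(x), which the average over x turns into [2 * Q e] as well; the mean weight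
   is at most 1. *)
pose c := 'E (fun x => weight x * Q (dir (m - X x))) / 4.
have unit_le e : `|e| = 1 -> c <= Q e.
  move=> e1; rewrite /c ler_pdivrMr//.
  apply: (@le_trans _ _ ('E (fun x => (2 * Q e) * weight x + 2 * spread e x))).
    apply: ler_ER => // [|x]; first by apply: bounded_rvD; exact: bounded_rvZ.
    rewrite /spread mulrCA [X in _ <= X + _]mulrC -mulrDr ler_wpM2l ?(ltW (weight_gt0 _))// e1 expr1n.
    have [->|u0] := eqVneq (m - X x) 0.
      rewrite /dir scaler0 -{1}(scale0r (0 : H)) QZ expr0n mul0r.
      by rewrite -(scale0r (0 : H)) (innerZr inner) mul0r expr0n subr0 addr_ge0// mulr_ge0.
    have f1 := norm_dir u0; set f := dir (m - X x) in f1 *.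
    apply: (@le_trans _ _ ('E (fun y => 2 * spread e y + (2 * (1 - '[e, f] ^+ 2)) * weight y))).
      apply: ler_ER => // [|y]; first by apply: bounded_rvD; exact: bounded_rvZ.
      rewrite /spread f1 e1 expr1n mulrCA [X in _ <= _ + X]mulrC -mulrDr.
      by rewrite ler_wpM2l ?(ltW (weight_gt0 _))// one_sub_inner_dir_triangle.
    rewrite (ERD P (bounded_rvZ _ _) (bounded_rvZ _ _))// !(ERZ P)// lerD2l.
    rewrite -[leRHS]mulr1 ler_wpM2l//; last first.
      by rewrite -[leRHS](ER_cst P) ler_ER//; exact: bounded_rv_cst.
    by rewrite mulr_ge0// subr_ge0 -(expr1n _ 2) -e1 inner_dir_sqr_le.
  rewrite (ERD P (bounded_rvZ _ _) (bounded_rvZ _ _))// !(ERZ P)// -/(Q e).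
  have : 'E weight <= 1 by rewrite -[leRHS](ER_cst P) ler_ER//; exact: bounded_rv_cst.
  by have := Q_ge0 e; nra.
exists c; last first.
  move=> v; have [->|v0] := eqVneq v 0.
    by rewrite normr0 expr0n mulr0 Q_ge0.
  rewrite -/(Q v) -[in leRHS](norm_dirK v) QZ mulrC ler_wpM2l ?sqr_ge0//.
  by apply: unit_le; exact: norm_dir.
(* If [c] were not positive, [Q] would vanish at the direction of [m - X] almost surely. That
   direction is a unit vector almost surely, since (A2) excludes an atom at [m]. *)
rewrite divr_gt0// ltNge; apply/negP => I0.
apply: (@ae_False _ _ _ P).
have [C C0 /(_ m)[_ _ _ _ ae0]] := inverse_moments separableH A2.
have := ae_eq0_Rintegral bounded_Q_dir (fun x => mulr_ge0 (ltW (weight_gt0 x)) (Q_ge0 _)) I0.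
apply: filterS2 ae0 => x u0 /eqP; rewrite mulf_eq0 gt_eqF//= => /eqP Q0.
by have := Q_gt0 (norm_dir u0); rewrite Q0 ltxx.
Qed.

End Coercivity.

(** * Growth of the gradient and its second-order expansion at the median *)

Section Linearization.
Context (R : realType) (H : completeNormedModType R) (inner : {dot H for idfun}).
Context (hilbertH : induces_norm inner) (separableH : separable H).
Context d (T : measurableType d) (P : probability T R).
Context (X : {RV P >-> borel H}).
Local Notation "''[' u , v ]" := (inner u v).
Local Notation "''E' f" := (Rintegral P setT f) (at level 10, f at level 9).
Implicit Types (e f u v w h : H).
Context (A1 : nondegenerate_orthogonally P inner X).
Context (A2 : bounded_inverse_moments P X).
Context (m : H) (median_m : geometric_median P X m).
Local Notation gradient := (gradient hilbertH separableH X).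

(** The bound is quadratic near [m] but only linear far away, and cannot be better: the gradient has
    norm at most 1. *)
Lemma gradient_coercive : exists2 c : R, 0 < c &
  forall h, c * `|h - m| ^+ 2 / (1 + `|h - m|) <= '[h - m, gradient h].
Proof.
have [c c0 cQ] := spread_coercive hilbertH separableH A1 A2 m.
exists (c / 2) => [|h]; first by rewrite divr_gt0.
have -> : '[h - m, gradient h] = '[h - m, gradient h] - '[h - m, gradient m].
  by rewrite (gradient_median hilbertH separableH A2 median_m) -(scale0r (0 : H)) (innerZr inner) mul0r subr0.
rewrite !gradientE -(ERB P); [|exact: bounded_inner_dir..].
have W1 : 0 < 1 + `|h - m| by rewrite ltr_wpDr.
have bS := bounded_spread hilbertH separableH X m (h - m).
apply: (@le_trans _ _ ('E (fun x => (2 * (1 + `|h - m|))^-1 * spread inner X m (h - m) x))).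
  rewrite (ERZ P)// [leRHS]mulrC ler_pdivlMr ?mulr_gt0//.
  apply: le_trans (cQ (h - m)).
  by rewrite le_eqVlt; apply/orP; left; apply/eqP; field; rewrite gt_eqF.
apply: ler_ER => [||x]; first exact: bounded_rvZ.
  by apply: bounded_rvB; exact: bounded_inner_dir.
rewrite -(innerBr inner).
have := inner_dir_coercive hilbertH (h - X x) (m - X x).
rewrite (_ : h - X x - (m - X x) = h - m); last by rewrite opprB addrA subrK.
by rewrite mulrC.
Qed.

(** The second derivative of the objective at [m]. A form suffices, without an operator: only
    additivity in [v] and coercivity on the diagonal are needed. *)
Definition hessian_form u v : R :=
  'E (fun x => `|m - X x|^-1 * ('[u, v] - '[u, dir (m - X x)] * '[v, dir (m - X x)])).

Let hessian_integrable u v : P.-integrable setT (EFin \o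
  (fun x => `|m - X x|^-1 * ('[u, v] - '[u, dir (m - X x)] * '[v, dir (m - X x)]))).
Proof.
have [C C0 /(_ m)[i1 _ _ _ _]] := inverse_moments separableH A2.
have mr : measurable_fun setT (fun x => `|m - X x|^-1).
  by apply: measurable_invr => //; exact: measurable_dist.
have [bu bv] := (bounded_inner_dir hilbertH separableH X u m,
                 bounded_inner_dir hilbertH separableH X v m).
have [mb [M Mb]] := bounded_rvB (bounded_rv_cst T '[u, v]) (bounded_rvM bu bv).
apply: (@le_integrable _ _ _ P _ measurableT _ (EFin \o (fun x => M * `|m - X x|^-1))).
- by apply/measurable_EFinP; exact: measurable_funM.
- move=> x _; rewrite /= lee_fin !normrM !normfV normr_id mulrC.
  by rewrite ler_wpM2r ?invr_ge0// (le_trans (Mb x))// ler_norm.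
- exact: integrable_scale.
Qed.

Lemma hessian_formDr u v w : hessian_form u (v + w) = hessian_form u v + hessian_form u w.
Proof.
rewrite -RintegralD//; apply: eq_Rintegral => x _.
by rewrite !(innerDr inner) !(innerDl inner); ring.
Qed.

Lemma hessian_form0r u : hessian_form u 0 = 0.
Proof. by have := hessian_formDr u 0 0; rewrite addr0 => /eqP; rewrite -subr_eq subrr eq_sym => /eqP. Qed.

Lemma hessian_form_sumr u I (s : seq I) (F : I -> H) :
  hessian_form u (\sum_(i <- s) F i) = \sum_(i <- s) hessian_form u (F i).
Proof.
elim: s => [|i s ih]; first by rewrite !big_nil hessian_form0r.
by rewrite !big_cons hessian_formDr ih.
Qed.

Lemma hessian_form_coercive : exists2 c : R, 0 < c &
  forall v, c * `|v| ^+ 2 <= hessian_form v v.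
Proof.
have [c c0 cQ] := spread_coercive hilbertH separableH A1 A2 m; exists c => // v.
apply: le_trans (cQ v) _.
have [C C0 /(_ m)[i1 _ _ _ ae0]] := inverse_moments separableH A2.
apply: ae_ler_Rintegral => //.
  by apply: bounded_rv_integrable; exact: bounded_spread.
apply: filterS ae0 => x x0.
rewrite /spread /weight (innerxx hilbertH) -expr2 ler_wpM2r//.
  by rewrite subr_ge0 inner_dir_sqr_le.
by rewrite lef_pV2 ?posrE ?normr_gt0// ?ltr_wpDr// lerDr.
Qed.

(** The remainder in [inner_dir_taylor] has [|m - X| ^+ 2] as denominator; here the second inverse
    moment of (A2) enters. *)
Lemma gradient_taylor : exists2 C : R, 0 < C & forall v h,
  `|'[v, gradient h] - hessian_form v (h - m)| <= C * `|v| * `|h - m| ^+ 2.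
Proof.
have [C C0 /(_ m)[_ i2 _ e2 ae0]] := inverse_moments separableH A2.
exists (5 / 2 * C) => [|v h]; first by rewrite !mulr_gt0.
have -> : '[v, gradient h] = '[v, gradient h] - '[v, gradient m].
  by rewrite (gradient_median hilbertH separableH A2 median_m) -(scale0r (0 : H)) (innerZr inner) mul0r subr0.
rewrite !gradientE -(ERB P); [|exact: bounded_inner_dir..].
have bB := bounded_rvB (bounded_inner_dir hilbertH separableH X v h)
  (bounded_inner_dir hilbertH separableH X v m).
have iB := bounded_rv_integrable P bB.
rewrite -RintegralB//.
have iD := integrable_diff iB (hessian_integrable v (h - m)).
apply: le_trans (le_normr_Rintegral measurableT iD) _.
apply: (@le_trans _ _ ('E (fun x => (5 / 2 * `|v| * `|h - m| ^+ 2) * (`|m - X x| ^+ 2)^-1))); last first.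
  rewrite RintegralZl// (_ : 5 / 2 * C * `|v| * `|h - m| ^+ 2 = 5 / 2 * `|v| * `|h - m| ^+ 2 * C); last by ring.
  by rewrite ler_wpM2l// !mulr_ge0// exprn_ge0.
apply: ae_ler_Rintegral.
- exact: (integrable_abse iD).
- exact: integrable_scale.
apply: filterS ae0 => x x0.
have := inner_dir_taylor hilbertH v (h - X x) x0.
rewrite (_ : h - X x - (m - X x) = h - m); last by rewrite opprB addrA subrK.
by rewrite (innerBr inner) [_^-1 * _]mulrC.
Qed.

(* At m the gradient is inverted up to a quadratic error, so the distance of
   an average of points to m is controlled by the sum of their gradients. *)
Lemma average_dist_le : exists c : R, exists2 C : R, 0 < c /\ 0 < C &
  forall I (s : seq I) (h : I -> H),
  c * `|\sum_(i <- s) (h i - m)|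
    <= `|\sum_(i <- s) gradient (h i)| + C * \sum_(i <- s) `|h i - m| ^+ 2.
Proof.
have [c c0 cQ] := hessian_form_coercive; have [C C0 hC] := gradient_taylor.
exists c, C => // I s h; set v := \sum_(i <- s) (h i - m).
have [v0|v0] := eqVneq v 0.
  by rewrite v0 normr0 mulr0 addr_ge0// mulr_ge0 ?(ltW C0)// sumr_ge0// => i _; exact: exprn_ge0.
have V0 : 0 < `|v| by rewrite normr_gt0.
(* The sum [v] is its own test vector: coercivity at [v] is expanded by additivity, each term is
   compared with a gradient, and one factor [|v|] is divided out. *)
rewrite -(ler_pM2r V0) -mulrA -expr2; apply: le_trans (cQ v) _.
rewrite {2}/v hessian_form_sumr.
apply: (@le_trans _ _ (\sum_(i <- s) ('[v, gradient (h i)] + C * `|v| * `|h i - m| ^+ 2))).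
  apply: ler_sum => i _; have := hC v (h i); rewrite ler_norml => /andP[h1 _].
  by lra.
rewrite big_split/= -(inner_sumr inner) -mulr_sumr mulrDl mulrAC lerD2r.
by rewrite [leRHS]mulrC (inner_le hilbertH).
Qed.

End Linearization.

(** * Scalar inequalities and step sizes *)

Section ScalarInequalities.
Context (R : realType).
Implicit Types (x y a b : R) (q : nat).

(** A second-order expansion whose remainder gains over [b ^+ q.+1]: one factor [b] is exchanged for
    [a], because the increment satisfies [y ^+ 2 <= a * b]. It serves both the Lyapunov function and
    the martingale of the noise. *)
Lemma expr_add_le q : exists2 K : R, 0 <= K & forall x y a b,
  0 <= x -> 0 <= x + y -> 0 <= a -> x + `|y| <= b -> y ^+ 2 <= a * b ->
  (x + y) ^+ q.+1 <= x ^+ q.+1 + q.+1%:R * x ^+ q * y + K * a * b ^+ q.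
Proof.
elim: q => [|q [K K0 ih]].
  by exists 0 => // x y a b *; rewrite !expr0 !expr1 !mul1r !mul0r addr0.
exists (q.+1%:R + K); first by rewrite addr_ge0.
move=> x y a b x0 xy0 a0 xb yab.
have b0 : 0 <= b by apply: le_trans xb; rewrite addr_ge0.
have xleb : x <= b by apply: le_trans xb; rewrite lerDl.
have xyb : x + y <= b by apply: le_trans xb; rewrite lerD2l ler_norm.
rewrite exprS; apply: le_trans (ler_wpM2l xy0 (ih x y a b x0 xy0 a0 xb yab)) _.
have h1 : q.+1%:R * x ^+ q * y ^+ 2 <= q.+1%:R * b ^+ q * (a * b).
  apply: ler_pM => //; first by rewrite mulr_ge0 ?exprn_ge0.
  - exact: sqr_ge0.
  - by rewrite ler_wpM2l// lerXn2r.
have h2 : (x + y) * (K * a * b ^+ q) <= b * (K * a * b ^+ q).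
  by rewrite ler_wpM2r// !mulr_ge0// exprn_ge0.
rewrite -subr_ge0.
set L := (X in 0 <= X).
have -> : L = (q.+1%:R * b ^+ q * (a * b) - q.+1%:R * x ^+ q * y ^+ 2)
  + (b * (K * a * b ^+ q) - (x + y) * (K * a * b ^+ q)).
  by rewrite /L -(natr1 q.+1) !exprS; ring.
by rewrite addr_ge0 ?subr_ge0.
Qed.

Lemma expr_tangent_le q x y : 0 <= x -> 0 <= x + y ->
  x ^+ q.+1 + q.+1%:R * x ^+ q * y <= (x + y) ^+ q.+1.
Proof.
move=> x0 xy0; elim: q => [|q ih]; first by rewrite !expr0 !expr1 !mul1r.
rewrite [leRHS]exprS; apply: le_trans (ler_wpM2l xy0 ih).
rewrite -subr_ge0; set L := (X in 0 <= X).
have -> : L = q.+1%:R * x ^+ q * y ^+ 2 by rewrite /L -(natr1 q.+1) !exprS; ring.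
by rewrite mulr_ge0 ?sqr_ge0// mulr_ge0 ?exprn_ge0.
Qed.

Lemma expR_le_quadratic x : x <= 3^-1 -> expR x <= 1 + x + x ^+ 2.
Proof.
move=> x3; have [x0|x0] := leP x 0.
  have h : 1 - x <= expR (- x) by have := expR_ge1Dx (- x).
  have x1 : 0 < 1 - x by lra.
  rewrite -[expR x]invrK -expRN; apply: (@le_trans _ _ (1 - x)^-1).
    by rewrite lef_pV2 ?posrE ?expR_gt0.
  rewrite -[(1 - x)^-1]mul1r ler_pdivrMr//.
  rewrite -subr_ge0 (_ : _ - 1 = - x * x ^+ 2); last by ring.
  by rewrite mulr_ge0 ?sqr_ge0 ?oppr_ge0.
(* Bounding [expR (- x)] by its tangent is too weak for positive [x]; halving the argument leaves
   the factor [1 - 3 * x + x ^+ 2], the origin of the threshold [3^-1]. *)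
have h : 1 - x / 2 <= expR (- (x / 2)) by have := expR_ge1Dx (- (x / 2)).
have x1 : 0 < 1 - x / 2 by lra.
have -> : expR x = expR (x / 2) ^+ 2 by rewrite -expRM_natl; congr expR; field.
apply: (@le_trans _ _ ((1 - x / 2)^-1 ^+ 2)).
  rewrite lerXn2r ?nnegrE ?expR_ge0 ?invr_ge0 ?(ltW x1)//.
  by rewrite -[expR _]invrK -expRN lef_pV2 ?posrE ?expR_gt0.
rewrite exprVn -[(_ ^+ 2)^-1]mul1r ler_pdivrMr ?exprn_gt0//.
rewrite -subr_ge0 (_ : _ - 1 = x ^+ 2 / 4 * (1 - 3 * x + x ^+ 2)); last by field.
rewrite mulr_ge0 ?divr_ge0 ?sqr_ge0//.
by have := sqr_ge0 x; lra.
Qed.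

(* The exponential growth makes the drift proportional to the function itself
   even far away from the minimiser, where the gradient is only bounded below. *)
Definition lyap (V : R) : R := expR (Num.sqrt (1 + V) - 1) - 1.

Lemma sqrt1D_ge1 V : 0 <= V -> 1 <= Num.sqrt (1 + V) :> R.
Proof. by move=> V0; rewrite -[leLHS]sqrtr1 ler_wsqrtr// lerDl. Qed.

Lemma lyap_ge0 V : 0 <= V -> 0 <= lyap V.
Proof. by move=> V0; rewrite subr_ge0 -[leLHS]expR0 ler_expR subr_ge0 sqrt1D_ge1. Qed.

(** Carries moment bounds from the Lyapunov function back to the squared distance. The 4 comes from
    squaring the tangent bound of the exponential at half its argument. *)
Lemma le_lyap V : 0 <= V -> V <= 4 * lyap V.
Proof.
move=> V0; rewrite /lyap; have s1 := sqrt1D_ge1 V0.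
have : Num.sqrt (1 + V) ^+ 2 = 1 + V by rewrite sqr_sqrtr// addr_ge0.
move: (Num.sqrt _) s1 => s s1 s2.
have h := expR_ge1Dx ((s - 1) / 2).
have e : expR (s - 1) = expR ((s - 1) / 2) ^+ 2 by rewrite -expRM_natl; congr expR; field.
have : (1 + (s - 1) / 2) ^+ 2 <= expR (s - 1).
  by rewrite e lerXn2r ?nnegrE ?expR_ge0//; lra.
by nra.
Qed.

(** With [V] the squared distance, the first bound pairs the derivative of [lyap] with the growth in
    [gradient_coercive]. The second one shows that the quadratic variation is proportional to
    [lyap V] near 0, and not merely to [1 + lyap V]. *)
Lemma lyap_drift V : 0 <= V ->
  lyap V / 4 <= (1 + lyap V) * (V / (1 + Num.sqrt V)) / Num.sqrt (1 + V) /\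
  (1 + lyap V) * (V / (1 + V)) <= 2 * lyap V.
Proof.
move=> V0; rewrite /lyap; have s1 := sqrt1D_ge1 V0.
have VE : V = Num.sqrt (1 + V) ^+ 2 - 1 by rewrite sqr_sqrtr ?addr_ge0// addrAC subrr add0r.
have sV : Num.sqrt V <= Num.sqrt (1 + V) by rewrite ler_wsqrtr// lerDr.
have sV0 := sqrtr_ge0 V.
move: (Num.sqrt (1 + V)) (Num.sqrt V) s1 VE sV sV0 => s t s1 VE st t0.
have s0 : 0 < s by lra.
have s21 : 0 < 1 + V by lra.
rewrite (_ : 1 + (expR (s - 1) - 1) = expR (s - 1)); last by ring.
set e := expR (s - 1).
have e0 : 0 < e by exact: expR_gt0.
have h1 : s <= e by have := expR_ge1Dx (s - 1); rewrite -/e; lra.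
(* For [s >= 2] the factor [2 * (s - 1)] is already at least [s]; below 2, the tangent bound for
   [e^-1] gives [e - 1 <= e * (s - 1)]. *)
have h2 : (e - 1) * s <= 2 * (s - 1) * e.
  have [s2|s2] := leP 2 s; first by nra.
  have := expR_ge1Dx (- (s - 1)); rewrite expRN -/e => h3.
  have h4 : 1 + (1 - s) <= e^-1 by lra.
  have : e * (1 + (1 - s)) <= 1 by rewrite -ler_pdivlMl// mulr1.
  by nra.
split; last first.
  rewrite mulrA ler_pdivrMr// (_ : 1 + V = s ^+ 2); last by rewrite VE; ring.
  rewrite VE; have : (s ^+ 2 - 1) <= 2 * s * (s - 1) by nra.
  have : (s - 1) * e <= s * (e - 1) by nra.
  by nra.
have t1 : 0 < 1 + t by lra.
rewrite (_ : e * _ / s = e * V / (s * (1 + t))); last by field; rewrite !gt_eqF.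
rewrite ler_pdivlMr ?mulr_gt0//.
have e1 : 1 <= e by lra.
have h3 : (e - 1) / 4 * (s * (1 + t)) <= (e - 1) / 4 * (s * (2 * s)).
  by rewrite ler_wpM2l ?divr_ge0 ?subr_ge0// ler_wpM2l ?(ltW s0)//; lra.
apply: (le_trans h3).
have -> : V = (s - 1) * (s + 1) by rewrite VE; ring.
have h4 : (e - 1) * s * s <= 2 * (s - 1) * e * s by rewrite ler_wpM2r// ltW.
have h5 : 0 <= e * (s - 1) by rewrite mulr_ge0 ?(ltW e0)// subr_ge0.
by nra.
Qed.

End ScalarInequalities.

(** * One step of the recursion for powers of the Lyapunov function *)

Section LyapunovStep.
Context (R : realType).

(** A pathwise bound in which the random [tau] is kept linear, to be averaged later. The remainder
    keeps the factor [(lyap V + gam) ^+ q]; a bare [gam ^+ 2] would lose the rate of the higher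
    moments. *)
Lemma lyap_step (q : nat) : exists2 C : R, 0 <= C & forall V V' tau gam : R,
  0 <= V -> 0 <= V' -> tau ^+ 2 <= V -> 0 < gam -> gam <= 4^-1 ->
  V' <= V + 2 * gam * tau + gam ^+ 2 ->
  lyap V' ^+ q.+1 <= lyap V ^+ q.+1
    + gam * (q.+1%:R * lyap V ^+ q * (1 + lyap V) / Num.sqrt (1 + V) * tau)
    + C * (gam ^+ 2 * (1 + lyap V) * (lyap V + gam) ^+ q).
Proof.
have [K K0 expand] := expr_add_le R q.
exists (5 * q.+1%:R + K * 8 * 4 ^+ q).
  by rewrite addr_ge0 ?mulr_ge0 ?exprn_ge0.
move=> V V' tau gam V0 V'0 tauV g0 g4 stepV.
have psi0 := lyap_ge0 V0.
have psi'0 := lyap_ge0 V'0.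
have kappa := (lyap_drift V0).2.
have s1 := sqrt1D_ge1 V0.
set s := Num.sqrt (1 + V) in s1 *.
have sE : s ^+ 2 = 1 + V by rewrite sqr_sqrtr ?addr_ge0.
have s0 : 0 < s by lra.
(* [D] bounds the increase of [Num.sqrt (1 + V)]; [gam <= 4^-1] keeps it below [3^-1], where
   [expR_le_quadratic] applies. *)
set t := tau / s; set D := gam * t + gam ^+ 2 / 2.
have tE : tau = t * s by rewrite divfK ?gt_eqF.
have t2 : t ^+ 2 <= V / (1 + V).
  by rewrite -sE ler_pdivlMr ?exprn_gt0// -exprMn -tE.
have t1 : t ^+ 2 <= 1.
  by rewrite (le_trans t2)// ler_pdivrMr ?mul1r ?lerDr//; lra.
have [tl tu] : - 1 <= t /\ t <= 1 by split; nra.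
have Dle : `|D| <= 2 * gam by rewrite ler_norml; apply/andP; split; rewrite /D; nra.
have D3 : D <= 3^-1.
  by have := ler_norm D; rewrite /D; nra.
have D2 : D ^+ 2 <= 2 * gam ^+ 2 * t ^+ 2 + gam ^+ 4 / 2.
  rewrite -subr_ge0 (_ : _ - _ = (gam * t - gam ^+ 2 / 2) ^+ 2) ?sqr_ge0//.
  by rewrite /D; field.
have D2' : D ^+ 2 <= 4 * gam ^+ 2.
  by move: Dle; rewrite ler_norml => /andP[]; nra.
have sD0 : 0 <= s + D.
  by move: Dle; rewrite ler_norml => /andP[]; lra.
have s'le : Num.sqrt (1 + V') <= s + D.
  rewrite -[leRHS]ger0_norm// -sqrtr_sqr ler_wsqrtr//.
  have -> : (s + D) ^+ 2 = 1 + V + 2 * gam * tau + gam ^+ 2 * s + D ^+ 2.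
    by rewrite tE -sE /D; field.
  have : gam ^+ 2 <= gam ^+ 2 * s by rewrite -{1}[gam ^+ 2]mulr1 ler_wpM2l// sqr_ge0.
  by have := sqr_ge0 D; lra.
set psi := lyap V in psi0 kappa *.
set Y := (1 + psi) * (D + D ^+ 2).
have psi'le : lyap V' <= psi + Y.
  rewrite /lyap lerBlDr.
  apply: (@le_trans _ _ (expR (s - 1) * expR D)).
    by rewrite -expRD ler_expR; lra.
  have -> : expR (s - 1) = 1 + psi by rewrite /psi /lyap -/s; ring.
  have h := expR_le_quadratic D3.
  have h1 : 0 <= 1 + psi by lra.
  by have := ler_wpM2l h1 h; rewrite /Y; lra.
have psiY0 : 0 <= psi + Y by exact: le_trans psi'le.
have h1 : 0 <= 1 + psi by lra.
have Yle : `|Y| <= (1 + psi) * (4 * gam).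
  rewrite /Y normrM ger0_norm// ler_wpM2l//.
  rewrite (_ : D + D ^+ 2 = D * (1 + D)); last by ring.
  rewrite normrM.
  have : `|1 + D| <= 2.
    by move: Dle; rewrite !ler_norml => /andP[? ?]; apply/andP; split; lra.
  by move: Dle (normr_ge0 D) (normr_ge0 (1 + D)); nra.
(* The hypothesis [y ^+ 2 <= a * b] of the expansion. Since [tau ^+ 2 <= V], [D ^+ 2] carries a
   factor [V / (1 + V)], and [kappa] turns one factor [1 + psi] into a multiple of [psi]. *)
have Y2 : Y ^+ 2 <= (8 * gam ^+ 2 * (1 + psi)) * (4 * (psi + gam)).
  have e1 : (D + D ^+ 2) ^+ 2 <= 4 * D ^+ 2.
    rewrite (_ : D + D ^+ 2 = D * (1 + D)); last by ring.
    rewrite exprMn mulrC ler_wpM2r ?sqr_ge0//.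
    by move: Dle; rewrite !ler_norml => /andP[? ?]; nra.
  have e2 : Y ^+ 2 <= (1 + psi) ^+ 2 * (8 * gam ^+ 2 * (V / (1 + V)) + 2 * gam ^+ 4).
    rewrite /Y exprMn ler_wpM2l ?sqr_ge0//; apply: (le_trans e1).
    have : 2 * gam ^+ 2 * t ^+ 2 <= 2 * gam ^+ 2 * (V / (1 + V)).
      by rewrite ler_wpM2l// mulr_ge0// sqr_ge0.
    by lra.
  apply: (le_trans e2).
  rewrite [leLHS](_ : _ = 8 * gam ^+ 2 * (1 + psi) * ((1 + psi) * (V / (1 + V)) +
    gam ^+ 2 / 4 * (1 + psi))); last by field; lra.
  rewrite ler_wpM2l ?mulr_ge0 ?exprn_ge0 ?(ltW g0)//.
  have g2 : gam ^+ 2 <= gam / 4 by nra.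
  have g3 : gam * psi <= 4^-1 * psi by rewrite ler_wpM2r.
  have : gam ^+ 2 * (1 + psi) <= gam / 4 * (1 + psi) by rewrite ler_wpM2r.
  by lra.
have sumY : psi + `|Y| <= 4 * (psi + gam).
  have g3 : gam * psi <= 4^-1 * psi by rewrite ler_wpM2r.
  by lra.
have a0 : 0 <= 8 * gam ^+ 2 * (1 + psi) by rewrite mulr_ge0// mulr_ge0// sqr_ge0.
apply: (@le_trans _ _ ((psi + Y) ^+ q.+1)); first by rewrite lerXn2r ?nnegrE.
apply: le_trans (expand psi Y _ _ psi0 psiY0 a0 sumY Y2) _.
have lin : q.+1%:R * psi ^+ q * Y <= gam * (q.+1%:R * psi ^+ q * (1 + psi) / s * tau)
    + 5 * q.+1%:R * (gam ^+ 2 * (1 + psi) * (psi + gam) ^+ q).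
  have -> : gam * (q.+1%:R * psi ^+ q * (1 + psi) / s * tau) =
      q.+1%:R * psi ^+ q * ((1 + psi) * (gam * t)).
    by rewrite tE; field; rewrite gt_eqF.
  have c0 : 0 <= q.+1%:R * psi ^+ q by rewrite mulr_ge0 ?exprn_ge0.
  have Yle2 : Y <= (1 + psi) * (gam * t) + 5 * (gam ^+ 2 * (1 + psi)).
    have : D + D ^+ 2 <= gam * t + 5 * gam ^+ 2.
      rewrite /D in D2' *.
      by have := sqr_ge0 gam; lra.
    by move=> /(ler_wpM2l h1); rewrite /Y; lra.
  apply: le_trans (ler_wpM2l c0 Yle2) _.
  rewrite mulrDr lerD2l.
  rewrite [leLHS](_ : _ = 5 * q.+1%:R * (gam ^+ 2 * (1 + psi) * psi ^+ q)); last by ring.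
  have pg0 : 0 <= psi + gam by rewrite addr_ge0// ltW.
  have pgq : psi ^+ q <= (psi + gam) ^+ q by rewrite lerXn2r ?nnegrE// lerDl ltW.
  rewrite ler_wpM2l ?mulr_ge0// ler_wpM2l// mulr_ge0// exprn_ge0// ltW//.
have -> : K * (8 * gam ^+ 2 * (1 + psi)) * (4 * (psi + gam)) ^+ q =
    K * 8 * 4 ^+ q * (gam ^+ 2 * (1 + psi) * (psi + gam) ^+ q).
  by rewrite exprMn; ring.
by rewrite mulrDl; lra.
Qed.

(** Either [gam] is small relative to [psi], and the remainder is a small part of the drift, or
    [psi] is at most a multiple of [gam], and everything is of order [gam ^+ q.+2]. *)
Lemma lyap_remainder_le (q : nat) (eps : R) : 0 < eps -> exists2 g0 : R, 0 < g0 &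
  exists2 C : R, 0 <= C & forall psi gam : R, 0 <= psi -> 0 < gam -> gam <= g0 ->
    gam ^+ 2 * (1 + psi) * (psi + gam) ^+ q <= eps * gam * psi ^+ q.+1 + C * gam ^+ q.+2.
Proof.
move=> eps0.
pose del := Num.min 1 (eps / (2 * 2 ^+ q)).
have q2 : 0 < 2 * 2 ^+ q :> R by rewrite mulr_gt0 ?exprn_gt0.
have del0 : 0 < del by rewrite lt_min ltr01 divr_gt0.
have del1 : del <= 1 by rewrite ge_min lexx.
have dele : del * (2 * 2 ^+ q) <= eps by rewrite -ler_pdivlMr// ge_min lexx orbT.
exists del => //; exists ((1 + del^-1) ^+ q.+1).
  by rewrite exprn_ge0// addr_ge0// invr_ge0 ltW.
move=> psi gam psi0 g0 gdel.
have dV0 : 0 <= del^-1 by rewrite invr_ge0 ltW.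
have d1V0 : 0 <= 1 + del^-1 by rewrite addr_ge0.
have gg0 := ltW g0; have ee0 := ltW eps0.
have pg0 : 0 <= psi + gam by rewrite addr_ge0.
have [small|large] := leP gam (del * psi).
  have h1 : (psi + gam) ^+ q <= 2 ^+ q * psi ^+ q.
    rewrite -exprMn lerXn2r ?nnegrE ?addr_ge0 ?mulr_ge0 ?(ltW g0)//.
    have : del * psi <= psi by rewrite -[leRHS]mul1r ler_wpM2r.
    by lra.
  apply: (@le_trans _ _ (eps * gam * psi ^+ q.+1)); last first.
    by rewrite lerDl mulr_ge0// exprn_ge0.
  have h2 : gam * (1 + psi) <= 2 * del * psi.
    have : gam * psi <= del * psi by rewrite ler_wpM2r.
    by lra.
  rewrite [leLHS](_ : _ = gam * ((gam * (1 + psi)) * (psi + gam) ^+ q)); last by ring.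
  rewrite [leRHS](_ : _ = gam * (eps * psi ^+ q.+1)); last by ring.
  rewrite ler_wpM2l ?(ltW g0)//.
  apply: (@le_trans _ _ (2 * del * psi * (2 ^+ q * psi ^+ q))).
    apply: ler_pM; [|exact: exprn_ge0|exact: h2|exact: h1].
    by apply: mulr_ge0 => //; exact: addr_ge0.
  rewrite [leLHS](_ : _ = del * (2 * 2 ^+ q) * psi ^+ q.+1); last by rewrite exprS; ring.
  by rewrite ler_wpM2r ?exprn_ge0.
have psile : psi <= gam / del by rewrite ler_pdivlMr// mulrC ltW.
have h1 : 1 + psi <= 1 + del^-1.
  by rewrite lerD2l (le_trans psile)// ler_pdivrMr// mulVf ?gt_eqF// (le_trans gdel).
have h2 : psi + gam <= (1 + del^-1) * gam.
  by rewrite mulrDl mul1r addrC lerD2l mulrC.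
apply: (@le_trans _ _ ((1 + del^-1) ^+ q.+1 * gam ^+ q.+2)); last first.
  by rewrite lerDr mulr_ge0 ?mulr_ge0 ?exprn_ge0.
rewrite [leRHS](_ : _ = gam ^+ 2 * (1 + del^-1) * ((1 + del^-1) * gam) ^+ q); last first.
  by rewrite exprMn !exprS; ring.
apply: ler_pM; last by rewrite lerXn2r ?nnegrE ?mulr_ge0.
- by apply: mulr_ge0; [exact: exprn_ge0|exact: addr_ge0].
- exact: exprn_ge0.
- by rewrite ler_wpM2l// exprn_ge0.
Qed.

End LyapunovStep.

Section WeightedSums.
Context (R : realType).

(** Jensen's inequality multiplied out, so that the total mass may be zero: tangent inequalities at
    [S] for the points [A * y i] are averaged with weights [v i]. *)
Lemma jensen_expr (I : eqType) (s : seq I) (v y : I -> R) (q : nat) :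
  (forall i, 0 <= v i) -> (forall i, 0 <= y i) ->
  (\sum_(i <- s) v i * y i) ^+ q.+1
    <= (\sum_(i <- s) v i) ^+ q * \sum_(i <- s) v i * y i ^+ q.+1.
Proof.
move=> v0 y0; set S := \sum_(i <- s) v i * y i; set A := \sum_(i <- s) v i.
have S0 : 0 <= S by apply: sumr_ge0 => i _; exact: mulr_ge0.
have A0 : 0 <= A by exact: sumr_ge0.
have W0 : 0 <= \sum_(i <- s) v i * y i ^+ q.+1.
  by apply: sumr_ge0 => i _; rewrite mulr_ge0// exprn_ge0.
have [AE|Ane] := eqVneq A 0.
  suff -> : S = 0 by rewrite expr0n mulr_ge0// exprn_ge0.
  move/eqP: AE; rewrite psumr_eq0// => /allP h.
  by rewrite /S big1_seq// => i /andP[_ /h /eqP ->]; rewrite mul0r.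
have {}A0 : 0 < A by rewrite lt_neqAle eq_sym Ane.
rewrite -(ler_pM2l A0) mulrA -exprS mulr_sumr.
apply: (@le_trans _ _ (\sum_(i <- s) v i * (S ^+ q.+1 + q.+1%:R * S ^+ q * (A * y i - S)))).
  have -> : \sum_(i <- s) v i * (S ^+ q.+1 + q.+1%:R * S ^+ q * (A * y i - S)) =
      A * S ^+ q.+1 + q.+1%:R * S ^+ q * (A * S - A * S).
    move: (S ^+ q.+1) (q.+1%:R * S ^+ q) => a k.
    under eq_bigr => i _.
      rewrite (_ : _ * _ = v i * a + k * (A * (v i * y i) - v i * S)); last by ring.
      over.
    by rewrite big_split/= -mulr_suml -mulr_sumr sumrB -mulr_sumr -mulr_suml.
  by rewrite subrr mulr0 addr0.
apply: ler_sum => i _; rewrite mulrCA ler_wpM2l// -exprMn.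
have := @expr_tangent_le R q S (A * y i - S) S0.
by rewrite addrC subrK; apply; rewrite mulr_ge0// ltW.
Qed.

Lemma sum_rsqrt_le n :
  \sum_(1 <= k < n.+1) (Num.sqrt (k%:R : R))^-1 <= 2 * Num.sqrt n%:R.
Proof.
elim: n => [|n ih]; first by rewrite big_geq// mulr_ge0.
rewrite big_nat_recr//=; apply: le_trans (lerD ih (lexx _)) _.
have a0 : 0 <= Num.sqrt (n%:R : R) by [].
have b0 : 0 < Num.sqrt (n.+1%:R : R) by rewrite sqrtr_gt0.
have : Num.sqrt (n.+1%:R : R) ^+ 2 = Num.sqrt (n%:R : R) ^+ 2 + 1.
  by rewrite !sqr_sqrtr// natr1.
move: (Num.sqrt (n%:R : R)) (Num.sqrt (n.+1%:R : R)) a0 b0 => a b a0 b0 ab.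
rewrite -(ler_pM2r b0) mulrDl mulVf ?gt_eqF//.
have := sqr_ge0 (a - b); nra.
Qed.

End WeightedSums.

(** * Step sizes and the recursions that they drive *)

Section StepSizes.
Context (R : realType).

(** The properties of a polynomial step size with exponent between 1/2 and 1 on which the rates
    rest, apart from the divergence of [n * gam n]. One constant serves both final bounds, which at
    [n = 1] give [gam 1 = c]. *)
Definition slow_steps (c : R) (gam : nat -> R) := forall n, (1 <= n)%N ->
  [/\ 0 < gam n, gam n.+1 <= gam n, gam n * (n%:R / n.+1%:R) <= gam n.+1,
      c <= n%:R * gam n & gam n * Num.sqrt n%:R <= c].

Lemma natr_powR_unbounded (b M : R) : 0 < b ->
  exists N, forall n, (N <= n)%N -> M <= n%:R `^ b.
Proof.
move=> b0; have M0 : 0 <= Num.max M 0 by rewrite le_max lexx orbT.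
exists (Num.bound (Num.max M 0 `^ b^-1)) => n Nn.
have h : Num.max M 0 `^ b^-1 <= n%:R.
  apply: le_trans (ltW (archi_boundP (powR_ge0 _ _))) _.
  by rewrite ler_nat.
apply: (@le_trans _ _ (Num.max M 0)); first by rewrite le_max lexx.
have bn0 : b != 0 by rewrite gt_eqF.
have e : Num.max M 0 = (Num.max M 0 `^ b^-1) `^ b by rewrite -powRrM mulVf// powRr1.
rewrite [leLHS]e; by apply: (ge0_ler_powR (ltW b0)); rewrite // ?nnegrE ?powR_ge0.
Qed.

Context (cg alpha : R) (alpha_gt : 2^-1 < alpha) (alpha_lt : alpha < 1) (cg_gt0 : 0 < cg).
Local Notation gam := (step_size cg alpha).

Let alpha_gt0 : 0 < alpha. Proof. by apply: lt_trans alpha_gt. Qed.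

Lemma step_size_slow : slow_steps cg gam.
Proof.
move=> n n1; rewrite /step_size !powRN.
have n0 : 0 < n%:R :> R by rewrite ltr0n.
have n1' : 1 <= n%:R :> R by rewrite ler1n.
have S0 : 0 < n.+1%:R :> R by [].
have na0 := powR_gt0 alpha n0; have Sa0 := powR_gt0 alpha S0.
split.
- by rewrite mulr_gt0// invr_gt0.
- rewrite ler_wpM2l ?(ltW cg_gt0)// lef_pV2 ?posrE//.
  by apply: ge0_ler_powR; rewrite ?nnegrE ?(ltW alpha_gt0)// ler_nat.
- have h : n.+1%:R `^ alpha = n%:R `^ alpha * (n.+1%:R / n%:R) `^ alpha :> R.
    by rewrite -powRM ?divr_ge0// mulrC divfK// gt_eqF.
  have q1 : 1 <= n.+1%:R / n%:R :> R by rewrite ler_pdivlMr// mul1r ler_nat.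
  have q0 : 0 < n.+1%:R / n%:R :> R by rewrite divr_gt0.
  have h2 : (n.+1%:R / n%:R) `^ alpha <= n.+1%:R / n%:R :> R.
    by rewrite -[leRHS]powRr1 ?(ltW q0)// ler_powR// ltW.
  rewrite -mulrA ler_wpM2l ?(ltW cg_gt0)// h invfM ler_wpM2l ?invr_ge0 ?(ltW na0)//.
  by rewrite -[leLHS]invrK invf_div lef_pV2 ?posrE ?powR_gt0.
- rewrite mulrCA ler_peMr ?(ltW cg_gt0)// ler_pdivlMr// mul1r.
  by rewrite -[leRHS]powRr1 ?(ltW n0)// ler_powR// ltW.
- rewrite -mulrA ger_pMr// mulrC ler_pdivrMr// mul1r -powR12_sqrt ?(ltW n0)//.
  by rewrite ler_powR// ltW.
Qed.

Lemma step_size_unbounded (M : R) : exists N, forall n, (N <= n)%N -> M <= n%:R * gam n.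
Proof.
have b0 : 0 < 1 - alpha by rewrite subr_gt0.
have [N NP] := natr_powR_unbounded (M / cg) b0.
exists N.+1 => n Nn; have := NP n (ltnW Nn); rewrite ler_pdivrMr// => /le_trans; apply.
have n0 : 0 < n%:R :> R by rewrite ltr0n (leq_trans _ Nn).
rewrite powRD; last by rewrite (gt_eqF n0) implybT.
by rewrite powRr1 ?(ltW n0)// mulrC mulrCA.
Qed.

End StepSizes.

Section Recursion.
Context (R : realType) (c : R) (gam : nat -> R).
Context (slow : slow_steps c gam).
Context (unbounded : forall M, exists N, forall n, (N <= n)%N -> M <= n%:R * gam n).

Lemma slow_steps_small (e : R) : 0 < e -> exists N, forall n, (N <= n)%N -> gam n <= e.
Proof.
move=> e0; have c0 : 0 < c.
  have [g0 _ _ _ h] := slow (leqnn 1).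
  by apply: lt_le_trans h; rewrite mulr_gt0// sqrtr_gt0.
exists (Num.bound ((c / e) ^+ 2)).+1 => n Nn.
have n0 : (0 < n)%N by exact: leq_ltn_trans Nn.
have [g0 _ _ _ h] := slow n0.
have s0 : 0 < Num.sqrt (n%:R : R) by rewrite sqrtr_gt0 ltr0n.
have ce0 : 0 <= c / e by rewrite divr_ge0 ?ltW.
have : c / e <= Num.sqrt n%:R.
  rewrite -[leLHS]ger0_norm// -sqrtr_sqr ler_wsqrtr//.
  by apply: le_trans (ltW (archi_boundP (sqr_ge0 _))) _; rewrite ler_nat ltnW.
rewrite ler_pdivrMr// mulrC => h2.
by rewrite -(ler_pM2r s0) (le_trans h).
Qed.

(** Induction on [x n <= C * gam n ^+ q.+1]. Half of the contraction pays for the decay of the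
    target from [n] to [n.+1], the other half absorbs the forcing term. *)
Lemma recursion_rate (x : nat -> R) (a K : R) (q n0 : nat) : 0 < a -> 0 <= K ->
  (forall n, (n0 <= n)%N -> x n.+1 <= (1 - a * gam n) * x n + K * gam n ^+ q.+2) ->
  exists2 C : R, 0 < C & forall n, (1 <= n)%N -> x n <= C * gam n ^+ q.+1.
Proof.
move=> a0 K0 rec.
have [N1 N1P] := slow_steps_small (divr_gt0 ltr01 a0).
have [N2 N2P] := unbounded (2 * q.+1%:R / a).
pose N := (maxn n0 (maxn N1 (maxn N2 1)))%N.
(* The first summand absorbs [K], the 1 gives positivity, and the finite sum covers every index up
   to [N]. *)
pose C := 2 * K / a + 1 + \sum_(1 <= k < N.+1) `|x k| / gam k ^+ q.+1.
have sum0 : 0 <= \sum_(1 <= k < N.+1) `|x k| / gam k ^+ q.+1.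
  rewrite big_nat; apply: sumr_ge0 => k /andP[k1 _].
  by have [g0 _ _ _ _] := slow k1; rewrite divr_ge0// exprn_ge0// ltW.
have CK : 0 <= 2 * K / a by apply: divr_ge0; [exact: mulr_ge0|exact: ltW].
have C0 : 0 < C by rewrite /C; lra.
have CKa : K <= C * (a / 2).
  have : K <= (2 * K / a + 1) * (a / 2).
    rewrite (_ : _ * _ = K + a / 2); last by field; rewrite gt_eqF.
    by rewrite lerDl divr_ge0 ?(ltW a0).
  by move=> /le_trans; apply; rewrite ler_wpM2r ?divr_ge0 ?(ltW a0)// lerDl.
have base n : (1 <= n)%N -> (n <= N)%N -> x n <= C * gam n ^+ q.+1.
  move=> n1 nN; have [g0 _ _ _ _] := slow n1.
  rewrite -ler_pdivrMr ?exprn_gt0//.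
  apply: (@le_trans _ _ (`|x n| / gam n ^+ q.+1)).
    by rewrite ler_wpM2r ?ler_norm// invr_ge0 exprn_ge0// ltW.
  apply: (@le_trans _ _ (\sum_(1 <= k < N.+1) `|x k| / gam k ^+ q.+1)); last by rewrite /C; lra.
  rewrite (bigD1_seq n) ?mem_index_iota ?iota_uniq ?n1//=.
  rewrite lerDl big_seq_cond; apply: sumr_ge0 => k /andP[].
  rewrite mem_index_iota => /andP[k1 _] _.
  by have [gk0 _ _ _ _] := slow k1; rewrite divr_ge0// exprn_ge0// ltW.
have step n : (N <= n)%N -> x n <= C * gam n ^+ q.+1 -> x n.+1 <= C * gam n.+1 ^+ q.+1.
  rewrite !geq_max => /and4P[nn0 nN1 nN2 n1] xn.
  have [g0 _ ratio _ _] := slow n1.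
  have ag1 : a * gam n <= 1.
    by rewrite -ler_pdivlMl// mulrC; exact: N1P.
  have gq0 : 0 <= gam n ^+ q.+1 by rewrite exprn_ge0// ltW.
  have n0' : 0 < n%:R :> R by rewrite ltr0n.
  (* Bernoulli's inequality: the relative loss of the target is at most [q.+1 / n.+1], hence at most
     half of [a * gam n] once [n * gam n] exceeds [2 * q.+1 / a]. *)
  have bern : 1 - a * gam n / 2 <= (n%:R / n.+1%:R) ^+ q.+1.
    have S0 : 0 < n.+1%:R :> R by [].
    have e : n%:R / n.+1%:R = 1 + - n.+1%:R^-1 :> R.
      by rewrite -[X in X / _](addrK 1) natr1 mulrBl divff ?gt_eqF// mul1r.
    rewrite e; have := @expr_tangent_le R q 1 (- n.+1%:R^-1) ler01.
    rewrite -e divr_ge0// => /(_ isT); rewrite e !expr1n mulr1 mulrN => /(le_trans _); apply.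
    rewrite lerD2l lerN2 ler_pdivrMr//.
    have := N2P n nN2; rewrite ler_pdivrMr// => h.
    have : n%:R * gam n * a <= n.+1%:R * gam n * a.
      by rewrite ler_wpM2r ?(ltW a0)// ler_wpM2r ?(ltW g0)// ler_nat.
    by move: (n.+1%:R : R) (n%:R : R) (q.+1%:R : R) h => u v w; lra.
  apply: le_trans (rec n nn0) _.
  apply: (@le_trans _ _ (C * gam n ^+ q.+1 * (1 - a * gam n / 2))).
    have h1 : (1 - a * gam n) * x n <= (1 - a * gam n) * (C * gam n ^+ q.+1).
      by rewrite ler_wpM2l// subr_ge0.
    have h2 : K * gam n ^+ q.+2 <= C * (a / 2) * gam n ^+ q.+2.
      by rewrite ler_wpM2r// exprn_ge0// ltW.
    apply: le_trans (lerD h1 h2) _; rewrite le_eqVlt; apply/orP; left; apply/eqP.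
    by rewrite (exprS _ q.+1); field.
  apply: (@le_trans _ _ (C * gam n ^+ q.+1 * (n%:R / n.+1%:R) ^+ q.+1)).
    by rewrite ler_wpM2l// mulr_ge0// ltW.
  rewrite -mulrA ler_wpM2l ?(ltW C0)// -exprMn lerXn2r ?nnegrE//.
    by rewrite mulr_ge0 ?divr_ge0// ltW.
  by have [g1 _ _ _ _] := slow (ltn0Sn n); exact: ltW.
exists C => // n n1; have [nN|Nn] := leqP n N; first exact: base.
have [m ->] : exists m, n = (N + m)%N by exists (n - N)%N; rewrite subnKC// ltnW.
elim: m => [|m ih]; last by rewrite addnS; apply: step => //; exact: leq_addr.
by rewrite addn0; apply: base => //; rewrite /N !leq_max leqnn !orbT.
Qed.

Lemma gam_gt0 n : (1 <= n)%N -> 0 < gam n.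
Proof. by move=> /slow[]. Qed.

Lemma slow_steps_pos : 0 < c.
Proof.
have [g0 _ _ _ h] := slow (leqnn 1).
by apply: lt_le_trans h; rewrite mulr_gt0// sqrtr_gt0.
Qed.

Lemma rsqrt_gam_le n : (1 <= n)%N -> (Num.sqrt (gam n))^-1 <= Num.sqrt n%:R / Num.sqrt c.
Proof.
move=> n1; have [g0 _ _ h _] := slow n1; have c0 := slow_steps_pos.
rewrite ler_pdivlMr ?sqrtr_gt0// mulrC ler_pdivrMr ?sqrtr_gt0// -sqrtrM ?ler0n//.
exact: ler_wsqrtr.
Qed.

(** The difference is an Abel summation weight; the square root of the step is the typical size of
    the distance to [m] that it multiplies. The products are O(n^{-1/2}), so they add up to O(sqrt
    n). *)
Lemma step_weight_le n : (1 <= n)%N ->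
  0 <= (gam n.+1)^-1 - (gam n)^-1 /\ Num.sqrt (gam n.+1) * ((gam n.+1)^-1 - (gam n)^-1)
    <= (Num.sqrt n.+1%:R)^-1 / Num.sqrt c.
Proof.
move=> n1; have [g0 noninc ratio _ _] := slow n1.
have g1 := gam_gt0 (ltn0Sn n); have c0 := slow_steps_pos.
have S0 : 0 < n.+1%:R :> R by [].
split; first by rewrite subr_ge0 lef_pV2 ?posrE.
have h : (gam n.+1)^-1 - (gam n)^-1 <= (gam n.+1)^-1 / n.+1%:R.
  have n0' : 0 < n%:R :> R by rewrite ltr0n.
  have : (gam n.+1)^-1 * (n%:R / n.+1%:R) <= (gam n)^-1.
    by rewrite ler_pdivrMl// ler_pdivlMr// mulrC.
  rewrite -(natr1 n) in S0 *; move: (n%:R : R) n0' S0 => k k0 S0.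
  have -> : (gam n.+1)^-1 / (k + 1) = (gam n.+1)^-1 - (gam n.+1)^-1 * (k / (k + 1)).
    by field; rewrite !gt_eqF.
  by lra.
apply: le_trans (ler_wpM2l (sqrtr_ge0 _) h) _.
have s0 : 0 < Num.sqrt (gam n.+1) by rewrite sqrtr_gt0.
have sn0 : 0 < Num.sqrt (n.+1%:R : R) by rewrite sqrtr_gt0.
have -> : Num.sqrt (gam n.+1) * ((gam n.+1)^-1 / n.+1%:R) =
    (Num.sqrt (gam n.+1))^-1 / n.+1%:R.
  rewrite -{2}(sqr_sqrtr (ltW g1)) mulrA; congr (_ * _).
  by rewrite expr2 invfM mulrA divff ?gt_eqF// mul1r.
rewrite -{1}(sqr_sqrtr (ltW S0)).
apply: (@le_trans _ _ (Num.sqrt n.+1%:R / Num.sqrt c / Num.sqrt n.+1%:R ^+ 2)).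
  by rewrite ler_wpM2r ?invr_ge0 ?sqr_ge0// rsqrt_gam_le.
rewrite le_eqVlt; apply/orP; left; apply/eqP.
by field; rewrite !gt_eqF// sqrtr_gt0.
Qed.

Lemma gam_le_rsqrt n : (1 <= n)%N -> gam n <= c * (Num.sqrt n%:R)^-1.
Proof.
by move=> n1; have [_ _ _ _ h] := slow n1; rewrite ler_pdivlMr// sqrtr_gt0 ltr0n.
Qed.

End Recursion.

(** * The stochastic gradient sequence *)

Section Filtration.
Context (R : realType) (H : completeNormedModType R).
Context d (T : measurableType d) (P : probability T R).
Context (Xs : nat -> {RV P >-> borel H}).

(** The pi-system of cylinders in the samples 1 to [n], hence the shift [k.+1]. It is closed under
    intersection, as freezing requires, unlike the plain union of the sigma-algebras of the
    samples. *)
Definition past (n : nat) : set (set T) :=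
  [set A | exists2 B : nat -> set (borel H), forall k, measurable (B k) &
    A = \bigcap_(k in `I_n) (Xs k.+1 @^-1` B k)].

Lemma past_measurable n : past n `<=` measurable.
Proof.
move=> _ [B mB ->]; apply: fin_bigcap_measurable; first exact: finite_II.
by move=> k _; rewrite -[_ @^-1` _]setTI; exact: measurable_funP.
Qed.

Lemma past_setT n : past n setT.
Proof.
exists (fun=> setT) => //; apply/esym; rewrite -subTset => x _ k _.
by rewrite preimage_setT.
Qed.

Lemma past_setI n : setI_closed (past n).
Proof.
move=> _ _ [B mB ->] [C mC ->]; exists (fun k => B k `&` C k).
  by move=> k; exact: measurableI.
by rewrite -bigcapI; apply: eq_bigcapr => k _; rewrite preimage_setI.
Qed.

Lemma past_preimage k n B : (k < n)%N -> measurable B -> past n (Xs k.+1 @^-1` B).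
Proof.
move=> kn mB; exists (fun j => if j == k then B else setT).
  by move=> j; case: eqP.
apply/seteqP; split=> [x Bx j _ /=|x /(_ k kn)/=]; last by rewrite eqxx.
by case: eqP => // ->.
Qed.

Lemma past_subS n : past n `<=` past n.+1.
Proof.
move=> _ [B mB ->]; exists (fun k => if (k < n)%N then B k else setT).
  by move=> k; case: ifP.
apply/seteqP; split=> x Bx k /= kn.
  by case: ifP => // {}kn; exact: Bx.
by have := Bx k (ltnW kn); rewrite /= kn.
Qed.

Lemma past_independent n A B : mutually_independent (fun n => Xs n.+1) ->
  past n A -> measurable B ->
  P (A `&` Xs n.+1 @^-1` B) = (P A * P (Xs n.+1 @^-1` B))%E.
Proof.
move=> indep [C mC ->] mB.
pose J k : {fset nat} := [fset i in iota 0 k]%fset.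
have inJ i k : (i \in J k) = (i < k)%N by rewrite !inE mem_iota.
have JE k : [set` J k] = `I_k by apply/seteqP; split=> i /=; rewrite inJ.
have JS : J n.+1 = (n |` J n)%fset.
  by apply/fsetP => i; rewrite in_fset1U !inJ ltnS leq_eqVlt.
(* A single family of events carries the cylinder and [B], so that independence can be applied to
   the first [n] and to the first [n.+1] indices and the two products compared. *)
pose C' k := if (k < n)%N then C k else B.
have mC' k : measurable (C' k) by rewrite /C'; case: ifP.
have capE : \bigcap_(k in `I_n) (Xs k.+1 @^-1` C k) = \bigcap_(k in `I_n) (Xs k.+1 @^-1` C' k).
  by apply: eq_bigcapr => k /= kn; rewrite /C' kn.
have -> : \bigcap_(k in `I_n) (Xs k.+1 @^-1` C k) `&` Xs n.+1 @^-1` B =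
    \bigcap_(k in [set` J n.+1]) (Xs k.+1 @^-1` C' k).
  rewrite capE JE; apply/seteqP; split=> x.
    move=> [h1 h2] k /=; rewrite ltnS leq_eqVlt => /orP[/eqP ->|]; last exact: h1.
    by rewrite /C' ltnn.
  by move=> h; split=> [k kn|]; [exact/h/ltnW|have := h n (ltnSn n); rewrite /= /C' ltnn].
rewrite (indep _ _ mC') capE -JE (indep _ _ mC') JS big_fsetU1/= ?inJ ?ltnn// muleC.
by rewrite {2}/C' ltnn.
Qed.

Definition past_type n := g_sigma_algebraType (past n).

Definition adapted n d' (E : measurableType d') (f : T -> E) :=
  measurable_fun setT (f : past_type n -> E).

Lemma adaptedS n d' (E : measurableType d') (f : T -> E) : adapted n f -> adapted n.+1 f.
Proof.
move=> mf _ B mB; rewrite setTI.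
have : <<s past n >> (f @^-1` B) by have := mf measurableT B mB; rewrite setTI.
by apply: sub_sigma_algebra2; exact: past_subS.
Qed.

Lemma adapted_measurable n d' (E : measurableType d') (f : T -> E) : adapted n f ->
  measurable_fun setT f.
Proof. exact: (measurable_fun_generated (@past_measurable n)). Qed.

Lemma adapted_sample k n : (k < n)%N -> adapted n (Xs k.+1).
Proof.
move=> kn _ B mB; rewrite setTI; apply: sub_gen_smallest.
exact: past_preimage.
Qed.

End Filtration.

(** * Adaptedness of the iterates and the mean of a sampled direction *)

Section StochasticGradient.
Context (R : realType) (H : completeNormedModType R) (inner : {dot H for idfun}).
Context (hilbertH : induces_norm inner) (separableH : separable H).
Context d (T : measurableType d) (P : probability T R).
Context (X : {RV P >-> borel H}).
Local Notation "''[' u , v ]" := (inner u v).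
Local Notation "''E' f" := (Rintegral P setT f) (at level 10, f at level 9).
Context (A2 : bounded_inverse_moments P X).
Local Notation gradient := (gradient hilbertH separableH X).
Context (Xs : nat -> {RV P >-> borel H}).
Context (indep_Xs : mutually_independent (fun n => Xs n.+1)).
Context (law_Xs : forall n, (1 <= n)%N -> same_law (Xs n) X).
Context (gam : nat -> R) (Z : nat -> T -> H).
Context (Z1_bounded : exists M : R, forall w, `|Z 1%N w| <= M).
Context (Z1_measurable : sigma_of (Z 1%N) `<=` sigma_of (Xs 1%N)).
Context (Z_rec : stochastic_gradient gam (fun n => Xs n) Z).

Definition sample_dir n w : H := dir (Z n w - Xs n.+1 w).

Lemma gradient_step n w : (1 <= n)%N -> Z n.+1 w = Z n w - gam n *: sample_dir n w.
Proof. by move=> n1; rewrite Z_rec// -scalerN -dirN opprB. Qed.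

Lemma adapted_iterate n : (1 <= n)%N -> adapted Xs n (Z n : T -> borel H).
Proof.
case: n => // n _; elim: n => [|n ih].
  move=> _ B mB; rewrite setTI.
  have /Z1_measurable[C mC] : sigma_of (Z 1%N) (Z 1%N @^-1` B) by exists B => //; rewrite setTI.
  by rewrite setTI => <-; apply: sub_gen_smallest; exact: past_preimage.
have zE : Z n.+2 = fun w => Z n.+1 w - gam n.+1 *: dir (Z n.+1 w - Xs n.+2 w).
  by apply/funext => w; rewrite gradient_step.
rewrite zE /adapted; apply: measurable_subv => //; first exact: adaptedS.
apply: measurable_scalev => //; apply: measurable_dir => //.
apply: measurable_subv => //; first exact: adaptedS.
exact: adapted_sample.
Qed.

(** The bound grows with [n] and gives no rate; it provides integrability. *)
Lemma bounded_iterate n : (1 <= n)%N -> exists M : R, forall w, `|Z n w| <= M.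
Proof.
case: n => // n _; elim: n => [//|n [M ZM]].
exists (M + `|gam n.+1|) => w; rewrite gradient_step//.
apply: le_trans (ler_normB _ _) _; apply: lerD => //.
by rewrite normrZ -[leRHS]mulr1 ler_wpM2l// norm_dir_le1.
Qed.

Lemma adapted_sample_dir n : (1 <= n)%N -> adapted Xs n.+1 (sample_dir n : T -> borel H).
Proof.
move=> n1; apply: measurable_dir => //; apply: measurable_subv => //.
  by apply: adaptedS; exact: adapted_iterate.
exact: adapted_sample.
Qed.

Lemma adapted_gradient n : (1 <= n)%N -> adapted Xs n (fun w => gradient (Z n w) : borel H).
Proof.
move=> n1; apply: measurable_continuous; last exact: adapted_iterate.
exact: continuous_gradient.
Qed.

(** The statement that the conditional mean of the sampled direction is the gradient, in weak form:
    both are tested against bounded vectors known before the next sample. *)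
Lemma expectation_sample_dir n (B : T -> H) : (1 <= n)%N ->
    adapted Xs n (B : T -> borel H) -> (exists M : R, forall w, `|B w| <= M) ->
  'E (fun w => '[B w, sample_dir n w]) = 'E (fun w => '[B w, gradient (Z n w)]).
Proof.
move=> n1 aB [M BM].
pose f (wy : past_type Xs n * borel H) : R := '[B wy.1, dir (Z n wy.1 - (wy.2 : H))].
have mfst (g : T -> borel H) : adapted Xs n g ->
    measurable_fun setT (fun wy : past_type Xs n * borel H => g wy.1).
  by move=> ag; exact: (measurableT_comp ag measurable_fst).
have bf : bounded_rv f.
  split; last first.
    exists M => wy; apply: le_trans (cauchy_schwarz hilbertH _ _) _.
    rewrite (le_trans _ (BM wy.1))// -[leRHS]mulr1 ler_wpM2l//.
    exact: norm_dir_le1.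
  apply: measurable_inner => //; first exact: mfst.
  apply: measurable_dir => //; apply: measurable_subv => //; first by apply: mfst; exact: adapted_iterate.
have -> := integral_freezing (@past_measurable _ _ _ _ _ Xs n) (past_setT Xs n)
  (@past_setI _ _ _ _ _ Xs n)
  (fun A C hA hC => past_independent indep_Xs hA hC) bf.
apply: eq_Rintegral => w _; rewrite gradientE /f /= /Rintegral; congr fine.
have mg : measurable_fun setT (fun y : borel H => ('[B w, dir (Z n w - (y : H))])%:E).
  apply/measurable_EFinP; apply: measurable_inner => //.
  by apply: measurable_dir => //; exact: measurable_subv.
transitivity (\int[distribution P X]_y ('[B w, dir (Z n w - (y : H))])%:E)%E.
  by apply: eq_measure_integral => A mA _; exact: law_Xs.
rewrite integral_distribution//.
apply: bounded_rv_integrable; exact: bounded_inner_dir.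
Qed.

End StochasticGradient.

Section BoundedLyapunov.
Context (R : realType) d (D : measurableType d).
Implicit Types V : D -> R.

Lemma le_lyap_mono (a b : R) : a <= b -> lyap a <= lyap b.
Proof. by move=> ab; rewrite lerB// ler_expR lerB// ler_wsqrtr// lerD2l. Qed.

Lemma measurable_sqrt V : measurable_fun setT V -> measurable_fun setT (fun x => Num.sqrt (V x)).
Proof.
move=> mV; apply: (@measurableT_comp _ _ _ _ _ _ (@Num.sqrt R)) => //.
by apply: continuous_measurable_fun; exact: sqrt_continuous.
Qed.

Lemma bounded_lyap V : bounded_rv V -> (forall x, 0 <= V x) ->
  bounded_rv (fun x => lyap (V x)).
Proof.
move=> [mV [M VM]] V0; split.
  apply: measurable_funB => //.
  apply: (measurableT_comp (@measurable_expR R)).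
  apply: measurable_funB => //; apply: measurable_sqrt.
  exact: measurable_funD.
exists (lyap M) => x; rewrite ger0_norm ?lyap_ge0//.
by apply: le_lyap_mono; apply: le_trans (VM x); exact: ler_norm.
Qed.

Lemma bounded_rsqrt1D V : bounded_rv V -> (forall x, 0 <= V x) ->
  bounded_rv (fun x => (Num.sqrt (1 + V x))^-1).
Proof.
move=> [mV _] V0; split.
  apply: measurable_invr => [|x]; last exact: sqrtr_ge0.
  by apply: measurable_sqrt; exact: measurable_funD.
exists 1 => x; have s1 := sqrt1D_ge1 (V0 x).
rewrite ger0_norm ?invr_ge0 ?(le_trans _ s1)//.
by rewrite invf_le1// (lt_le_trans _ s1).
Qed.

End BoundedLyapunov.

(** * Moments of every order of the distance from the iterates to the median *)

Section IterateMoments.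
Context (R : realType) (H : completeNormedModType R) (inner : {dot H for idfun}).
Context (hilbertH : induces_norm inner) (separableH : separable H).
Context d (T : measurableType d) (P : probability T R).
Context (X : {RV P >-> borel H}).
Local Notation "''[' u , v ]" := (inner u v).
Local Notation "''E' f" := (Rintegral P setT f) (at level 10, f at level 9).
Context (A1 : nondegenerate_orthogonally P inner X).
Context (A2 : bounded_inverse_moments P X).
Context (m : H) (median_m : geometric_median P X m).
Local Notation gradient := (gradient hilbertH separableH X).
Context (Xs : nat -> {RV P >-> borel H}).
Context (indep_Xs : mutually_independent (fun n => Xs n.+1)).
Context (law_Xs : forall n, (1 <= n)%N -> same_law (Xs n) X).
Context (c : R) (gam : nat -> R) (Z : nat -> T -> H).
Context (slow : slow_steps c gam).
Context (unbounded : forall M, exists N, forall n, (N <= n)%N -> M <= n%:R * gam n).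
Context (Z1_bounded : exists M : R, forall w, `|Z 1%N w| <= M).
Context (Z1_measurable : sigma_of (Z 1%N) `<=` sigma_of (Xs 1%N)).
Context (Z_rec : stochastic_gradient gam (fun n => Xs n) Z).

Lemma bounded_rv_past n (f : T -> R) : bounded_rv (f : past_type Xs n -> R) -> bounded_rv f.
Proof. by move=> [mf bf]; split=> //; exact: adapted_measurable mf. Qed.

Lemma bounded_dist n : (1 <= n)%N ->
  bounded_rv ((fun w => `|Z n w - m|) : past_type Xs n -> R).
Proof.
move=> n1; split.
  apply: measurable_norm => //; apply: measurable_subv => //.
  exact: (adapted_iterate separableH Z1_measurable Z_rec n1).
have [M ZM] := bounded_iterate Z1_bounded Z_rec n1.
exists (M + `|m|) => w; rewrite normr_id.
by apply: le_trans (ler_normB _ _) _; rewrite lerD2r.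
Qed.

Local Notation sqdist n w := (`|Z n w - m| ^+ 2).
Local Notation psi n w := (lyap (sqdist n w)).

Lemma bounded_psi n : (1 <= n)%N -> bounded_rv ((fun w => psi n w) : past_type Xs n -> R).
Proof.
move=> n1; apply: bounded_lyap => [|x]; last exact: sqr_ge0.
by apply: bounded_rvX; exact: bounded_dist.
Qed.

Lemma expectation_drift n (A : T -> R) : (1 <= n)%N ->
    bounded_rv (A : past_type Xs n -> R) ->
  'E (fun w => A w * '[Z n w - m, sample_dir Xs Z n w])
    = 'E (fun w => A w * '[Z n w - m, gradient (Z n w)]).
Proof.
move=> n1 bA.
have aZ := adapted_iterate separableH Z1_measurable Z_rec n1.
have [_ [M ZM]] := bounded_dist n1.
have [mA [N AN]] := bA.
have aB : adapted Xs n ((fun w => A w *: (Z n w - m)) : T -> borel H).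
  by apply: measurable_scalev => //; exact: measurable_subv.
have bB : exists M : R, forall w, `|A w *: (Z n w - m)| <= M.
  exists (N * M) => w; rewrite normrZ; apply: ler_pM => //.
  by have := ZM w; rewrite normr_id.
have := expectation_sample_dir hilbertH separableH indep_Xs law_Xs Z1_measurable Z_rec n1 aB bB.
by under eq_Rintegral do rewrite (innerZl inner); under [RHS]eq_Rintegral do rewrite (innerZl inner).
Qed.

Lemma bounded_inner_sample n (A : T -> R) : (1 <= n)%N ->
  bounded_rv (A : past_type Xs n -> R) ->
  bounded_rv (fun w => A w * '[Z n w - m, sample_dir Xs Z n w]) /\
  bounded_rv (fun w => A w * '[Z n w - m, gradient (Z n w)]).
Proof.
move=> n1 bA.
have aZ := adapted_iterate separableH Z1_measurable Z_rec n1.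
have [_ [M ZM]] := bounded_dist n1.
have mT : measurable_fun setT ((fun w => Z n w - m) : T -> borel H).
  by apply: measurable_subv => //; exact: adapted_measurable aZ.
have bnd (f : T -> H) : measurable_fun setT (f : T -> borel H) -> (forall w, `|f w| <= 1) ->
    bounded_rv (fun w => A w * '[Z n w - m, f w]).
  move=> mf f1; apply: bounded_rvM; first exact: bounded_rv_past bA.
  split; first exact: measurable_inner.
  exists M => w; apply: le_trans (cauchy_schwarz hilbertH _ _) _.
  rewrite -[leRHS]mulr1; apply: ler_pM => //.
  by have := ZM w; rewrite normr_id.
split; apply: bnd => [|w]; last exact: norm_gradient.
- exact: adapted_measurable (adapted_sample_dir separableH Z1_measurable Z_rec n1).
- exact: norm_dir_le1.
- exact: adapted_measurable (adapted_gradient hilbertH separableH A2 Z1_measurable Z_rec n1).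
Qed.

Lemma lyap_iterate_step n w : (1 <= n)%N -> exists2 tau : R,
  tau ^+ 2 <= sqdist n w /\ sqdist n.+1 w <= sqdist n w + 2 * gam n * tau + gam n ^+ 2 &
  tau = - '[Z n w - m, sample_dir Xs Z n w].
Proof.
move=> n1; exists (- '[Z n w - m, sample_dir Xs Z n w]) => //; split.
  rewrite sqrrN -[leLHS]real_normK ?num_real// ler_pXn2r ?nnegrE//.
  apply: le_trans (cauchy_schwarz hilbertH _ _) _.
  by rewrite -[leRHS]mulr1 ler_wpM2l// norm_dir_le1.
rewrite (gradient_step Z_rec w n1) addrAC (normB_sqr hilbertH (Z n w - m)) (innerZr inner).
have : `|gam n *: sample_dir Xs Z n w| ^+ 2 <= gam n ^+ 2.
  rewrite normrZ exprMn real_normK ?num_real// -[leRHS]mulr1 ler_wpM2l ?sqr_ge0//.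
  by rewrite exprn_ile1// norm_dir_le1.
by move: '[_, _] => t; lra.
Qed.

Lemma lyap_moments (q : nat) : exists2 C : R, 0 < C & forall n, (1 <= n)%N ->
  'E (fun w => psi n w ^+ q.+1) <= C * gam n ^+ q.+1.
Proof.
have [c1 c10 coer] := gradient_coercive hilbertH separableH A1 A2 median_m.
have [K K0 step] := lyap_step R q.
have K10 : 0 < 8 * (K + 1) by rewrite mulr_gt0// ltr_wpDl.
(* The tolerance makes [K] times the remainder cost at most [c1 / 8] of drift; the drift is worth
   [c1 / 4], and a contraction at rate [c1 / 8] remains. *)
have [g0 g00 [K' K'0 rem]] := lyap_remainder_le q (divr_gt0 c10 K10).
have g40 : 0 < Num.min 4^-1 g0 by rewrite lt_min g00 andbT invr_gt0.
have [N NP] := slow_steps_small slow g40.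
apply: (recursion_rate slow unbounded (a := c1 / 8) (K := K * K') (n0 := maxn N 1)).
- by rewrite divr_gt0.
- by rewrite mulr_ge0.
move=> n; rewrite geq_max => /andP[/NP + n1]; rewrite le_min => /andP[gn4 gng0].
have gn0 : 0 < gam n by case: (slow n1).
(* The coefficient of the linear term in [lyap_step]. It depends on [Z n] alone, so the sampled
   direction beside it may be replaced by the gradient in expectation. *)
pose A w := q.+1%:R * psi n w ^+ q * (1 + psi n w) / Num.sqrt (1 + sqdist n w).
have psi0 k w : 0 <= psi k w by apply: lyap_ge0; exact: sqr_ge0.
have bpsi := bounded_psi n1.
have bA : bounded_rv (A : past_type Xs n -> R).
  apply: bounded_rvM.
    apply: bounded_rvM; first by apply: bounded_rvZ; exact: bounded_rvX.
    by apply: bounded_rvD => //; exact: bounded_rv_cst.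
  apply: bounded_rsqrt1D => [|w]; last exact: sqr_ge0.
  by apply: bounded_rvX; exact: bounded_dist.
have [bS bG] := bounded_inner_sample n1 bA.
have bq : bounded_rv (fun w => psi n w ^+ q.+1).
  by apply: (@bounded_rv_past n); exact: bounded_rvX.
have bq1 : bounded_rv (fun w => psi n.+1 w ^+ q.+1).
  by apply: (@bounded_rv_past n.+1); apply: bounded_rvX; exact: bounded_psi.
pose k := c1 / 8.
apply: (@le_trans _ _ ('E (fun w => ((1 + k * gam n) * psi n w ^+ q.+1
    - gam n * (A w * '[Z n w - m, sample_dir Xs Z n w])) + K * K' * gam n ^+ q.+2))).
  apply: ler_ER => // [|w].
    by apply: bounded_rvD; [apply: bounded_rvB; exact: bounded_rvZ|exact: bounded_rv_cst].
  have [tau [tau2 stepV] tauE] := lyap_iterate_step w n1.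
  have := step _ _ _ _ (sqr_ge0 _) (sqr_ge0 _) tau2 gn0 gn4 stepV.
  move=> /le_trans; apply; rewrite tauE -/(A w) mulrN mulrN.
  have h := rem (psi n w) (gam n) (psi0 n w) gn0 gng0.
  have h2 : K * (gam n ^+ 2 * (1 + psi n w) * (psi n w + gam n) ^+ q) <=
      K * (c1 / (8 * (K + 1)) * gam n * psi n w ^+ q.+1 + K' * gam n ^+ q.+2).
    by rewrite ler_wpM2l.
  have h3 : K * (c1 / (8 * (K + 1))) <= k.
    rewrite (_ : _ * _ = k * (K / (K + 1))); last by rewrite /k; field; rewrite !gt_eqF// ltr_wpDl.
    rewrite -[leRHS]mulr1 ler_wpM2l ?divr_ge0 ?(ltW c10)//.
    by rewrite ler_pdivrMr ?mul1r ?lerDl// ltr_wpDl.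
  have h4 : K * (c1 / (8 * (K + 1))) * (gam n * psi n w ^+ q.+1) <= k * (gam n * psi n w ^+ q.+1).
    by rewrite ler_wpM2r// mulr_ge0 ?exprn_ge0// ltW.
  by move: (A w * _) h2 h4 => a; rewrite mulrDr; lra.
rewrite (ERD P); [|by apply: bounded_rvB; exact: bounded_rvZ|exact: bounded_rv_cst].
rewrite (ERB P (bounded_rvZ _ bq) (bounded_rvZ _ bS)) (ERZ P _ bq) (ERZ P _ bS).
rewrite (expectation_drift n1 bA) ER_cst lerD2r.
have drift : c1 / 4 * 'E (fun w => psi n w ^+ q.+1) <= 'E (fun w => A w * '[Z n w - m, gradient (Z n w)]).
  rewrite -(ERZ P)//; apply: ler_ER => // [|w]; first exact: bounded_rvZ.
  have s1 := sqrt1D_ge1 (sqr_ge0 `|Z n w - m|).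
  have A0 : 0 <= A w.
    apply: divr_ge0; last exact: sqrtr_ge0.
    by apply: mulr_ge0; [rewrite mulr_ge0 ?exprn_ge0|exact: addr_ge0].
  apply: le_trans (ler_wpM2l A0 (coer (Z n w))).
  have := (lyap_drift (sqr_ge0 `|Z n w - m|)).1.
  rewrite sqrtr_sqr normr_id.
  set t := `|Z n w - m|; set s := Num.sqrt _; set p := lyap _ => h.
  rewrite (_ : A w * _ = c1 * q.+1%:R * p ^+ q * ((1 + p) * (t ^+ 2 / (1 + t)) / s)); last first.
    by rewrite /A -/s -/p -/t; ring.
  apply: (@le_trans _ _ (c1 * q.+1%:R * p ^+ q * (p / 4))); last first.
    by rewrite ler_wpM2l// !mulr_ge0 ?exprn_ge0 ?(ltW c10)// psi0.
  rewrite (_ : c1 * q.+1%:R * p ^+ q * (p / 4) = c1 / 4 * p ^+ q.+1 * q.+1%:R); last first.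
    by rewrite exprS; ring.
  by rewrite ler_peMr ?ler1n// mulr_ge0 ?exprn_ge0 ?divr_ge0 ?(ltW c10)// psi0.
have := ler_wpM2l (ltW gn0) drift; rewrite /k.
by move: ('E _) ('E _) => e1 e2; lra.
Qed.

Lemma iterate_moments (q : nat) : exists2 C : R, 0 < C & forall n, (1 <= n)%N ->
  'E (fun w => (sqdist n w) ^+ q.+1) <= C * gam n ^+ q.+1.
Proof.
have [C C0 CP] := lyap_moments q; exists (4 ^+ q.+1 * C); first by rewrite mulr_gt0 ?exprn_gt0.
move=> n n1; rewrite -mulrA; apply: le_trans (ler_wpM2l _ (CP n n1)); last exact: exprn_ge0.
have bq : bounded_rv (fun w => psi n w ^+ q.+1).
  by apply: (@bounded_rv_past n); apply: bounded_rvX; exact: bounded_psi.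
rewrite -(ERZ P)//; apply: ler_ER => [||w].
- by apply: bounded_rvX; apply: bounded_rvX; apply: (@bounded_rv_past n); exact: bounded_dist.
- exact: bounded_rvZ.
rewrite -exprMn lerXn2r ?nnegrE ?sqr_ge0//.
  by rewrite mulr_ge0// lyap_ge0 ?sqr_ge0.
by apply: le_lyap; exact: sqr_ge0.
Qed.

End IterateMoments.

(** * Calculus of sequences of order sqrt n *)

Section RootGrowth.
Context d (T : measurableType d) (R : realType) (P : probability T R).
Local Notation "''E' f" := (Rintegral P setT f) (at level 10, f at level 9).
Implicit Types (F G : nat -> T -> R).

(* The index is shifted: this is a bound in the norm of L^{2(p+1)}. *)
Definition root_growth (p : nat) F := (forall n, bounded_rv (F n)) /\
  (forall n w, 0 <= F n w) /\
  exists2 C : R, 0 <= C & forall n, (1 <= n)%N ->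
    'E (fun w => F n w ^+ (2 * p.+1)) <= C * n%:R ^+ p.+1.

Lemma root_growthD p F G : root_growth p F -> root_growth p G ->
  root_growth p (fun n w => F n w + G n w).
Proof.
move=> [bF [F0 [C C0 hC]]] [bG [G0 [D D0 hD]]].
split; [by move=> n; exact: bounded_rvD|split; first by move=> n w; exact: addr_ge0].
exists (2 ^+ (2 * p.+1) * (C + D)); first by rewrite mulr_ge0 ?exprn_ge0 ?addr_ge0.
move=> n n1; have bFX := bounded_rvX (2 * p.+1) (bF n).
have bGX := bounded_rvX (2 * p.+1) (bG n).
rewrite -mulrA mulrDl; apply: le_trans (ler_wpM2l _ (lerD (hC n n1) (hD n n1))); last exact: exprn_ge0.
rewrite -(ERD P)// -(ERZ P); last exact: bounded_rvD.
apply: ler_ER => [||w].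
- by apply: bounded_rvX; exact: bounded_rvD.
- by apply: bounded_rvZ; exact: bounded_rvD.
have [FG|/ltW FG] := leP (F n w) (G n w).
  apply: (@le_trans _ _ ((2 * G n w) ^+ (2 * p.+1))).
    by rewrite lerXn2r ?nnegrE ?addr_ge0 ?mulr_ge0//; lra.
  by rewrite exprMn ler_wpM2l ?exprn_ge0// lerDr exprn_ge0.
apply: (@le_trans _ _ ((2 * F n w) ^+ (2 * p.+1))).
  by rewrite lerXn2r ?nnegrE ?addr_ge0 ?mulr_ge0//; lra.
by rewrite exprMn ler_wpM2l ?exprn_ge0// lerDl exprn_ge0.
Qed.

Lemma root_growth_le p F G : (forall n, bounded_rv (F n)) -> (forall n w, 0 <= F n w) ->
  root_growth p G -> (forall n w, (1 <= n)%N -> F n w <= G n w) -> root_growth p F.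
Proof.
move=> bF F0 [bG [G0 [C C0 hC]]] FG; do 2 split=> //; exists C => // n n1.
apply: le_trans (hC n n1); apply: ler_ER => [||w]; [exact: bounded_rvX..|].
by rewrite lerXn2r ?nnegrE ?FG.
Qed.

(** The weights have total mass O(sqrt n), and by Jensen a weighted sum of variables bounded in a
    common L^{2(p+1)} norm is of the order of that mass. *)
Lemma root_growth_sum p (v : nat -> R) (y : nat -> T -> R) (C D : R) :
  (forall k, 0 <= v k) -> (forall k, bounded_rv (y k)) -> (forall k w, 0 <= y k w) ->
  0 <= C -> 0 <= D -> (forall k, 'E (fun w => y k w ^+ (2 * p.+1)) <= C) ->
  (forall k, v k <= D * (Num.sqrt k.+1%:R)^-1) ->
  root_growth p (fun n w => \sum_(0 <= k < n) v k * y k w).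
Proof.
move=> v0 by_ y0 C0 D0 hC hD.
split; first by move=> n; apply: bounded_rv_sum => k; exact: bounded_rvZ.
split; first by move=> n w; apply: sumr_ge0 => k _; exact: mulr_ge0.
exists ((2 * D) ^+ (2 * p.+1) * C).
  by rewrite mulr_ge0// exprn_ge0// mulr_ge0.
move=> n n1; pose A := \sum_(0 <= k < n) v k.
have A0 : 0 <= A by exact: sumr_ge0.
have AD : A <= 2 * D * Num.sqrt n%:R.
  have := ler_wpM2l D0 (sum_rsqrt_le R n).
  rewrite big_add1/= mulr_sumr mulrA (mulrC D) => /(le_trans _); apply.
  by apply: ler_sum => k _.
have e2 : (2 * p.+1 = (2 * p).+1.+1)%N by rewrite mulnS.
have byX k : bounded_rv (fun w => v k * y k w ^+ (2 * p.+1)).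
  by apply: bounded_rvZ; exact: bounded_rvX.
apply: (@le_trans _ _ ('E (fun w => A ^+ (2 * p).+1 * \sum_(0 <= k < n) v k * y k w ^+ (2 * p.+1)))).
  apply: ler_ER => [||w].
  - by apply: bounded_rvX; apply: bounded_rv_sum => k; exact: bounded_rvZ.
  - by apply: bounded_rvZ; exact: bounded_rv_sum.
  rewrite e2; exact: jensen_expr.
rewrite (ERZ P); last exact: bounded_rv_sum.
rewrite (ER_sum P _ byX).
apply: (@le_trans _ _ (A ^+ (2 * p).+1 * (A * C))).
  rewrite ler_wpM2l ?exprn_ge0// /A mulr_suml; apply: ler_sum => k _.
  by rewrite (ERZ P); [rewrite ler_wpM2l|exact: bounded_rvX].
rewrite mulrA -exprSr -e2 mulrAC ler_wpM2r//.
have -> : n%:R ^+ p.+1 = Num.sqrt n%:R ^+ (2 * p.+1) :> R by rewrite exprM sqr_sqrtr.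
by rewrite -exprMn lerXn2r ?nnegrE ?mulr_ge0.
Qed.

End RootGrowth.

(** * The five contributions to the centred sum of the iterates *)

Section AverageMoments.
Context (R : realType) (H : completeNormedModType R) (inner : {dot H for idfun}).
Context (hilbertH : induces_norm inner) (separableH : separable H).
Context d (T : measurableType d) (P : probability T R).
Context (X : {RV P >-> borel H}).
Local Notation "''[' u , v ]" := (inner u v).
Local Notation "''E' f" := (Rintegral P setT f) (at level 10, f at level 9).
Context (A1 : nondegenerate_orthogonally P inner X).
Context (A2 : bounded_inverse_moments P X).
Context (m : H) (median_m : geometric_median P X m).
Local Notation gradient := (gradient hilbertH separableH X).
Context (Xs : nat -> {RV P >-> borel H}).
Context (indep_Xs : mutually_independent (fun n => Xs n.+1)).
Context (law_Xs : forall n, (1 <= n)%N -> same_law (Xs n) X).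
Context (c : R) (gam : nat -> R) (Z : nat -> T -> H).
Context (slow : slow_steps c gam).
Context (unbounded : forall M, exists N, forall n, (N <= n)%N -> M <= n%:R * gam n).
Context (Z1_bounded : exists M : R, forall w, `|Z 1%N w| <= M).
Context (Z1_measurable : sigma_of (Z 1%N) `<=` sigma_of (Xs 1%N)).
Context (Z_rec : stochastic_gradient gam (fun n => Xs n) Z).
Local Notation sample_dir := (sample_dir Xs Z).

Definition noise k w : H := gradient (Z k w) - sample_dir k w.
Definition noise_sum n w : H := \sum_(0 <= k < n) noise k.+1 w.

Lemma norm_noise k w : `|noise k w| <= 2.
Proof.
apply: le_trans (ler_normB _ _) _; rewrite mulr2n -[1 + 1]/(1 + 1 : R).
by apply: lerD; [exact: norm_gradient|exact: norm_dir_le1].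
Qed.

Lemma adapted_noise k : adapted Xs k.+2 (noise k.+1 : T -> borel H).
Proof.
apply: measurable_subv => //.
  apply: adaptedS.
  exact: (adapted_gradient hilbertH separableH A2 Z1_measurable Z_rec).
exact: (adapted_sample_dir separableH Z1_measurable Z_rec).
Qed.

Lemma adapted_noise_sum n : adapted Xs n.+1 (noise_sum n : T -> borel H).
Proof.
elim: n => [|n ih].
  rewrite (_ : noise_sum 0 = cst 0); first exact: measurable_cst.
  by apply/funext => w; rewrite /noise_sum big_geq.
rewrite (_ : noise_sum n.+1 = fun w => noise_sum n w + noise n.+1 w).
  by apply: measurable_addv => //; [exact: adaptedS|exact: adapted_noise].
by apply/funext => w; rewrite /noise_sum big_nat_recr.
Qed.

Lemma norm_noise_sum n w : `|noise_sum n w| <= 2 * n%:R.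
Proof.
elim: n => [|n ih]; first by rewrite /noise_sum big_geq// normr0 mulr0.
rewrite /noise_sum big_nat_recr//= -(natr1 n) mulrDr mulr1.
by apply: le_trans (ler_normD _ _) _; apply: lerD => //; exact: norm_noise.
Qed.

Let bounded_norm_noise_sum n :
  bounded_rv ((fun w => `|noise_sum n w| ^+ 2 + 1) : past_type Xs n.+1 -> R).
Proof.
apply: bounded_rvD; last exact: bounded_rv_cst.
apply: bounded_rvX; split; first by apply: measurable_norm => //; exact: adapted_noise_sum.
by exists (2 * n%:R) => w; rewrite normr_id; exact: norm_noise_sum.
Qed.

Let bounded_inner_noise n (A : T -> R) (f : T -> H) (M : R) :
  bounded_rv (A : past_type Xs n.+1 -> R) ->
  measurable_fun setT (f : T -> borel H) -> (forall w, `|f w| <= M) ->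
  bounded_rv (fun w => A w * '[noise_sum n w, f w]).
Proof.
move=> bA mf fM; apply: bounded_rvM; first exact: bounded_rv_past bA.
split.
  apply: measurable_inner => //; exact (adapted_measurable (@adapted_noise_sum n)).
exists (2 * n%:R * M) => w; apply: le_trans (cauchy_schwarz hilbertH _ _) _.
by apply: ler_pM => //; exact: norm_noise_sum.
Qed.

Lemma expectation_noise n (A : T -> R) : bounded_rv (A : past_type Xs n.+1 -> R) ->
  'E (fun w => A w * '[noise_sum n w, noise n.+1 w]) = 0.
Proof.
move=> bA; have [mA [N AN]] := bA.
have aB : adapted Xs n.+1 ((fun w => A w *: noise_sum n w) : T -> borel H).
  by apply: measurable_scalev => //; exact: adapted_noise_sum.
have bB : exists M : R, forall w, `|A w *: noise_sum n w| <= M.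
  exists (N * (2 * n%:R)) => w; rewrite normrZ; apply: ler_pM => //.
  exact: norm_noise_sum.
have := expectation_sample_dir hilbertH separableH indep_Xs law_Xs Z1_measurable Z_rec
  (ltn0Sn n) aB bB.
under eq_Rintegral do rewrite (innerZl inner).
under [in RHS]eq_Rintegral do rewrite (innerZl inner).
move=> e.
under eq_Rintegral do rewrite /noise (innerBr inner) mulrBr.
rewrite (ERB P); [by rewrite e subrr| |].
- apply: (bounded_inner_noise (M := 1)) => // [|w]; last exact: norm_gradient.
  exact: adapted_measurable (adapted_gradient hilbertH separableH A2 Z1_measurable Z_rec _).
- apply: (bounded_inner_noise (M := 1)) => // [|w]; last exact: norm_dir_le1.
  exact: adapted_measurable (adapted_sample_dir separableH Z1_measurable Z_rec _).
Qed.

(** Induction on [p], then on [n]: the cross term has mean zero, so passing to [n.+1] costs a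
    multiple of the moment of order [p], of size [n.+1 ^ p], and these costs add up to order [p.+1].
    The added 1 lets the bounded increments be compared with the sum even when the latter is
    small. *)
Lemma noise_sum_moments p : exists2 C : R, 0 <= C & forall n,
  'E (fun w => (`|noise_sum n w| ^+ 2 + 1) ^+ p) <= C * n.+1%:R ^+ p.
Proof.
elim: p => [|p [C C0 ih]].
  exists 1 => // n; rewrite expr0 mulr1 -[leRHS](ER_cst P).
  by under eq_Rintegral do rewrite expr0.
have [K K0 expand] := expr_add_le R p.
(* The first term comes from squared increments of size at most 4, the second from [expr_add_le]
   with [a = 7] and [b = 7 * x w]. *)
pose K' := 4 * p.+1%:R + K * 7 * 7 ^+ p.
have K'0 : 0 <= K' by rewrite addr_ge0 ?mulr_ge0 ?exprn_ge0.
exists (K' * C + 1); first by rewrite addr_ge0 ?mulr_ge0.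
elim=> [|n ihn].
  under eq_Rintegral do rewrite /noise_sum big_geq// normr0 expr0n add0r expr1n.
  by rewrite ER_cst expr1n mulr1 lerDr mulr_ge0.
pose x w := `|noise_sum n w| ^+ 2 + 1.
have bx k : bounded_rv ((fun w => x w ^+ k) : past_type Xs n.+1 -> R).
  by apply: bounded_rvX; exact: bounded_norm_noise_sum.
have bxT k : bounded_rv (fun w => x w ^+ k) := bounded_rv_past (bx k).
have bI : bounded_rv (fun w => x w ^+ p * '[noise_sum n w, noise n.+1 w]).
  apply: (bounded_inner_noise (M := 2)) => // [|w]; last exact: norm_noise.
  exact (adapted_measurable (@adapted_noise n)).
apply: (@le_trans _ _ ('E (fun w => (x w ^+ p.+1 + K' * x w ^+ p)
    + 2 * p.+1%:R * (x w ^+ p * '[noise_sum n w, noise n.+1 w])))).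
  apply: ler_ER => [||w].
  - apply: (@bounded_rv_past _ _ _ _ _ Xs n.+2); apply: bounded_rvX.
    exact: bounded_norm_noise_sum.
  - by apply: bounded_rvD; [apply: bounded_rvD|]; rewrite //; exact: bounded_rvZ.
  have x1 : 1 <= x w by rewrite lerDr sqr_ge0.
  have Sx : 2 * `|noise_sum n w| <= x w.
    by rewrite /x; have := sqr_ge0 (`|noise_sum n w| - 1); nra.
  set I := '[noise_sum n w, noise n.+1 w].
  pose y := 2 * I + `|noise n.+1 w| ^+ 2.
  have IS : `|I| <= 2 * `|noise_sum n w|.
    apply: le_trans (cauchy_schwarz hilbertH _ _) _.
    by rewrite mulrC ler_wpM2r// norm_noise.
  have N4 : `|noise n.+1 w| ^+ 2 <= 4.
    by have := norm_noise n.+1 w; have := normr_ge0 (noise n.+1 w); nra.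
  have N0 : 0 <= `|noise n.+1 w| ^+ 2 by exact: sqr_ge0.
  have xyE : `|noise_sum n.+1 w| ^+ 2 + 1 = x w + y.
    have -> : noise_sum n.+1 w = noise_sum n w + noise n.+1 w by rewrite /noise_sum big_nat_recr.
    by rewrite (normD_sqr hilbertH (noise_sum n w)) /x /y -/I; ring.
  have yS : `|y| <= 4 * `|noise_sum n w| + 4.
    move: IS; rewrite /y !ler_norml => /andP[i1 i2]; apply/andP; split; lra.
  have xy0 : 0 <= x w + y by rewrite -xyE addr_ge0// sqr_ge0.
  have x0 : 0 <= x w by lra.
  have yb : x w + `|y| <= 7 * x w by lra.
  have y2 : y ^+ 2 <= 7 * (7 * x w).
    rewrite -[leLHS]real_normK ?num_real//.
    have := sqr_ge0 (`|noise_sum n w| - 1).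
    by move: yS (normr_ge0 y) (normr_ge0 (noise_sum n w)); rewrite /x; nra.
  rewrite xyE; apply: le_trans (expand _ _ _ _ x0 xy0 _ yb y2) _ => //.
  have xp0 : 0 <= x w ^+ p by rewrite exprn_ge0.
  have h : p.+1%:R * x w ^+ p * y <= p.+1%:R * x w ^+ p * (2 * I + 4).
    by rewrite ler_wpM2l ?mulr_ge0// lerD2l.
  rewrite exprMn (_ : K * 7 * (7 ^+ p * x w ^+ p) = K * 7 * 7 ^+ p * x w ^+ p); last by ring.
  by rewrite /K'; move: h; move: (x w ^+ p) (7 ^+ p : R) (p.+1%:R : R) => a b e h; lra.
rewrite (ERD P) ?(ERZ P) ?expectation_noise ?mulr0 ?addr0//; last 2 first.
- by apply: bounded_rvD => //; exact: bounded_rvZ.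
- exact: bounded_rvZ.
rewrite (ERD P) ?(ERZ P)//; last exact: bounded_rvZ.
apply: le_trans (lerD ihn (ler_wpM2l K'0 (ih n))) _.
rewrite -(natr1 n.+1); move: (n.+1%:R : R) (ler0n R n.+1) => k k0.
have h : k ^+ p.+1 + k ^+ p <= (k + 1) ^+ p.+1.
  rewrite exprSr [leRHS]exprSr -[X in _ + X]mulr1 -mulrDr ler_wpM2r ?addr_ge0//.
  by rewrite lerXn2r ?nnegrE ?addr_ge0// lerDl.
have kp0 : 0 <= k ^+ p by exact: exprn_ge0.
have D0 : 0 <= K' * C + 1 by rewrite addr_ge0 ?mulr_ge0.
have := ler_wpM2l D0 h; lra.
Qed.

(* Abel summation in [sample_dir k = (Z k - Z k.+1) / gam k]. *)
Lemma sum_sample_dir n w : \sum_(0 <= k < n.+1) sample_dir k.+1 w =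
  (gam 1%N)^-1 *: (Z 1%N w - m) - (gam n.+1)^-1 *: (Z n.+2 w - m)
  + \sum_(0 <= k < n) ((gam k.+2)^-1 - (gam k.+1)^-1) *: (Z k.+2 w - m).
Proof.
have dirE k : sample_dir k.+1 w =
      (gam k.+1)^-1 *: (Z k.+1 w - m) - (gam k.+1)^-1 *: (Z k.+2 w - m).
  rewrite -scalerBr opprB addrA subrK (gradient_step Z_rec w (ltn0Sn k)) opprB addrC subrK.
  by rewrite scalerA mulVf ?scale1r// gt_eqF// (gam_gt0 slow).
elim: n => [|n ih].
  by rewrite big_nat1 big_geq// addr0 dirE.
rewrite big_nat_recr//= ih dirE [in RHS]big_nat_recr//= scalerBl.
rewrite -!addrA; congr (_ + _).
by rewrite (addrA (\sum_(0 <= k < n) _)) [LHS]addrC addrAC [LHS]addrC -(addrA (\sum_(0 <= k < n) _)).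
Qed.

Let bounded_Z n : bounded_rv (fun w => `|Z n.+1 w - m|).
Proof.
apply: (@bounded_rv_past _ _ _ _ _ Xs n.+1).
exact: (bounded_dist separableH m Z1_bounded Z1_measurable Z_rec).
Qed.

Let scaled_moments (q : nat) : exists2 C : R, 0 <= C & forall k,
  'E (fun w => (`|Z k.+1 w - m| ^+ 2 / gam k.+1) ^+ q.+1) <= C.
Proof.
have [C C0 CP] := iterate_moments hilbertH separableH A1 A2 median_m indep_Xs law_Xs slow
  unbounded Z1_bounded Z1_measurable Z_rec q.
exists C; first exact: ltW.
move=> k; have g0 := gam_gt0 slow (ltn0Sn k).
under eq_Rintegral do rewrite expr_div_n mulrC.
rewrite (ERZ P); last by apply: bounded_rvX; apply: bounded_rvX; exact: bounded_Z.
by rewrite mulrC ler_pdivrMr ?exprn_gt0// CP.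
Qed.

Lemma average_moments (p : nat) : exists2 C : R, 0 < C & forall n, (1 <= n)%N ->
  'E (fun w => `|\sum_(0 <= k < n) (Z k.+1 w - m)| ^+ (2 * p.+1)) <= C * n%:R ^+ p.+1.
Proof.
have [l [K [l0 K0] lK]] := average_dist_le hilbertH separableH A1 A2 median_m.
have c0 := slow_steps_pos slow.
have sc0 : 0 < Num.sqrt c by rewrite sqrtr_gt0.
(* Errors rescaled by their typical size, hence bounded in each moment uniformly in [k]. *)
pose y k w := `|Z k.+1 w - m| / Num.sqrt (gam k.+1).
have g0 k := gam_gt0 slow (ltn0Sn k).
have sg0 k : 0 < Num.sqrt (gam k.+1) by rewrite sqrtr_gt0.
have by_ k : bounded_rv (y k).
  by apply: bounded_rvM; [exact: bounded_Z|exact: bounded_rv_cst].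
have y0 k w : 0 <= y k w by rewrite divr_ge0// ltW.
have [C1 C10 yC] : exists2 C : R, 0 <= C & forall k, 'E (fun w => y k w ^+ (2 * p.+1)) <= C.
  have [C C0 hC] := scaled_moments p; exists C => // k; apply: le_trans (hC k).
  rewrite le_eqVlt; apply/orP; left; apply/eqP; apply: eq_Rintegral => w _.
  by rewrite exprM /y expr_div_n sqr_sqrtr// ltW.
have e2 : (2 * p.+1 = (2 * p).+1.+1)%N by rewrite mulnS.
(* The quadratic errors need twice the order of moments used for [y]. *)
have [C2 C20 y2C] : exists2 C : R, 0 <= C & forall k,
    'E (fun w => (`|Z k.+1 w - m| ^+ 2 / gam k.+1) ^+ (2 * p.+1)) <= C.
  by rewrite e2; exact: scaled_moments.
have by2 k : bounded_rv (fun w => `|Z k.+1 w - m| ^+ 2 / gam k.+1).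
  by apply: bounded_rvM; [apply: bounded_rvX; exact: bounded_Z|exact: bounded_rv_cst].
have rg_noise : root_growth P p (fun n w => `|noise_sum n w|).
  split.
    move=> n; apply: (@bounded_rv_past _ _ _ _ _ Xs n.+1); split.
      by apply: measurable_norm => //; exact: adapted_noise_sum.
    by exists (2 * n%:R) => w; rewrite normr_id; exact: norm_noise_sum.
  split=> //; have [C C0 hC] := noise_sum_moments p.+1.
  exists (C * 2 ^+ p.+1) => [|n n1]; first by rewrite mulr_ge0// exprn_ge0.
  have h1 : n.+1%:R ^+ p.+1 <= 2 ^+ p.+1 * n%:R ^+ p.+1 :> R.
    by rewrite -exprMn lerXn2r ?nnegrE ?mulr_ge0// -natrM ler_nat mul2n -addnn -add1n leq_add2r.
  rewrite -mulrA; apply: le_trans (ler_wpM2l C0 h1); apply: le_trans (hC n).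
  have bN := bounded_rv_past (bounded_norm_noise_sum n).
  apply: ler_ER => [||w]; last 1 first.
  - by rewrite exprM lerXn2r ?nnegrE ?sqr_ge0 ?addr_ge0 ?sqr_ge0// lerDl.
  - rewrite (_ : (fun w => _) = fun w => ((`|noise_sum n w| ^+ 2 + 1) - 1) ^+ p.+1); last first.
      by apply/funext => w; rewrite addrK exprM.
    by apply: bounded_rvX; apply: bounded_rvB => //; exact: bounded_rv_cst.
  - exact: bounded_rvX.
have rg_first : root_growth P p (fun _ w => (gam 1%N)^-1 * `|Z 1%N w - m|).
  have b1 : bounded_rv (fun w => (gam 1%N)^-1 * `|Z 1%N w - m|).
    by apply: bounded_rvZ; exact: bounded_Z.
  split; first by [].
  split; first by move=> _ w; rewrite mulr_ge0// invr_ge0 ltW.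
  exists ('E (fun w => ((gam 1%N)^-1 * `|Z 1%N w - m|) ^+ (2 * p.+1))).
    by apply: ER_ge0 => w; rewrite exprn_ge0// mulr_ge0// invr_ge0 ltW.
  move=> n n1; rewrite ler_peMr ?exprn_ege1 ?ler1n//.
  by apply: ER_ge0 => w; rewrite exprn_ge0// mulr_ge0// invr_ge0 ltW.
have rg_last : root_growth P p (fun n w => Num.sqrt n%:R / Num.sqrt c * y n w).
  split; first by move=> n; exact: bounded_rvZ.
  split; first by move=> n w; rewrite mulr_ge0// divr_ge0.
  exists ((Num.sqrt c)^-1 ^+ (2 * p.+1) * C1) => [|n n1].
    by rewrite mulr_ge0// exprn_ge0// invr_ge0 ltW.
  under eq_Rintegral do rewrite exprMn.
  rewrite (ERZ P); last exact: bounded_rvX.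
  rewrite exprMn (_ : Num.sqrt n%:R ^+ (2 * p.+1) = n%:R ^+ p.+1); last first.
    by rewrite exprM sqr_sqrtr.
  have v0 : 0 <= (Num.sqrt c)^-1 ^+ (2 * p.+1) by rewrite exprn_ge0// invr_ge0 ltW.
  move: ((Num.sqrt c)^-1 ^+ (2 * p.+1)) v0 => v v0.
  rewrite [leRHS](_ : _ = n%:R ^+ p.+1 * v * C1); last by ring.
  by rewrite ler_wpM2l// mulr_ge0 ?exprn_ge0.
have rg_mid : root_growth P p (fun n w => \sum_(0 <= k < n)
    (Num.sqrt (gam k.+2) * ((gam k.+2)^-1 - (gam k.+1)^-1)) * y k.+1 w).
  apply: (root_growth_sum (C := C1) (D := (Num.sqrt c)^-1)) => //.
  - by move=> k; rewrite mulr_ge0//; have [] := step_weight_le slow (ltn0Sn k).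
  move=> k; have [_ h] := step_weight_le slow (ltn0Sn k).
  apply: (le_trans h); rewrite mulrC ler_wpM2l ?invr_ge0//.
  by rewrite lef_pV2 ?posrE ?sqrtr_gt0// ler_wsqrtr// ler_nat.
have rg_sqr : root_growth P p (fun n w => \sum_(0 <= k < n)
    (K * gam k.+1) * (`|Z k.+1 w - m| ^+ 2 / gam k.+1)).
  apply: (root_growth_sum (C := C2) (D := K * c)) => //.
  - by move=> k; rewrite mulr_ge0// ltW.
  - by move=> k w; rewrite divr_ge0 ?sqr_ge0// ltW.
  - by rewrite mulr_ge0// ltW.
  move=> k; rewrite -mulrA ler_wpM2l ?(ltW K0)//.
  exact: gam_le_rsqrt.
have rg := root_growthD (root_growthD (root_growthD (root_growthD
  rg_noise rg_first) rg_last) rg_mid) rg_sqr.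
have bV n : bounded_rv (fun w => l * `|\sum_(0 <= k < n) (Z k.+1 w - m)|).
  split.
    apply: measurable_funM => //; apply: measurable_norm => //.
    apply: measurable_sumv => // k; apply: measurable_subv => //.
    exact (adapted_measurable (adapted_iterate separableH Z1_measurable Z_rec (ltn0Sn k))).
  have [_ [N hN]] : bounded_rv (fun w => \sum_(0 <= k < n) `|Z k.+1 w - m|).
    by apply: bounded_rv_sum => k; exact: bounded_Z.
  exists (l * N) => w; rewrite normrM normr_id gtr0_norm// ler_wpM2l ?(ltW l0)//.
  apply: le_trans (ler_norm_sum _ _ _) _; apply: le_trans (hN w); exact: ler_norm.
have [_ [_ [C C0 hC]]] : root_growth P p (fun n w => l * `|\sum_(0 <= k < n) (Z k.+1 w - m)|).
  apply: root_growth_le bV _ rg _ => [n w|n w]; first by rewrite mulr_ge0// ltW.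
  case: n => // n _; have := lK _ (index_iota 0 n.+1) (fun k => Z k.+1 w).
  move=> /le_trans; apply.
  have -> : \sum_(0 <= k < n.+1) gradient (Z k.+1 w) =
      noise_sum n.+1 w + \sum_(0 <= k < n.+1) sample_dir k.+1 w.
    by rewrite -big_split/=; apply: eq_bigr => k _; rewrite subrK.
  apply: lerD; last first.
    rewrite mulr_sumr le_eqVlt; apply/orP; left; apply/eqP; apply: eq_bigr => k _.
    by rewrite -mulrA; congr (_ * _); rewrite mulrCA mulfV ?mulr1// gt_eqF.
  apply: le_trans (ler_normD _ _) _; rewrite -!addrA lerD2l sum_sample_dir.
  apply: le_trans (ler_normD _ _) _; rewrite addrA; apply: lerD.
    apply: le_trans (ler_normB _ _) _; rewrite !normrZ !gtr0_norm ?invr_gt0// lerD2l.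
    (* The boundary term pairs [Z n.+2] with [gam n.+1], whereas [y n.+1] is scaled by [gam n.+2];
       monotone steps make up for the shift. *)
    rewrite /y [leRHS]mulrA [leRHS]mulrAC ler_wpM2r//.
    rewrite -[in leLHS](sqr_sqrtr (ltW (g0 n))) expr2 invfM.
    have [_ noninc _ _ _] := slow (ltn0Sn n).
    apply: ler_pM; rewrite ?invr_ge0//; first exact: rsqrt_gam_le.
    by rewrite lef_pV2 ?posrE// ler_wsqrtr.
  apply: le_trans (ler_norm_sum _ _ _) _.
  (* The sum in [rg_mid] has one more term than the Abel sum; it is nonnegative and is dropped. *)
  rewrite big_nat_recr//= -[leLHS]addr0 lerD//; last first.
    by rewrite mulr_ge0// mulr_ge0//; have [] := step_weight_le slow (ltn0Sn n).
  rewrite le_eqVlt; apply/orP; left; apply/eqP; apply: eq_bigr => k _.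
  have [w0 _] := step_weight_le slow (ltn0Sn k).
  rewrite normrZ ger0_norm// /y.
  by field; rewrite !gt_eqF.
exists (C / l ^+ (2 * p.+1) + 1).
  by rewrite ltr_wpDl// divr_ge0// exprn_ge0// ltW.
move=> n n1; apply: (@le_trans _ _ (C / l ^+ (2 * p.+1) * n%:R ^+ p.+1)); last first.
  by rewrite ler_wpM2r ?exprn_ge0// lerDl.
rewrite mulrAC ler_pdivlMr ?exprn_gt0// mulrC; apply: le_trans (hC n n1).
rewrite -(ERZ P).
  by rewrite le_eqVlt; apply/orP; left; apply/eqP; apply: eq_Rintegral => w _; rewrite exprMn.
rewrite (_ : (fun w => _) = fun w => (l^-1 * (l * `|\sum_(0 <= k < n) (Z k.+1 w - m)|)) ^+ (2 * p.+1)).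
  by apply: bounded_rvX; apply: bounded_rvZ; exact: bV.
by apply/funext => w; rewrite mulKf// gt_eqF.
Qed.

End AverageMoments.

Theorem theorem4p2 (R : realType)
  (H : completeNormedModType R) (inner : {dot H for idfun})
  (hilbertH : induces_norm inner) (separableH : separable H)
  (d : measure_display) (T : measurableType d) (P : probability T R)
  (X : {RV P >-> borel H})
  (A1 : nondegenerate_orthogonally P inner X)
  (A2 : bounded_inverse_moments P X)
  (m : H) (median_m : geometric_median P X m)
  (alpha cg : R) (alpha_gt : 2^-1 < alpha) (alpha_lt : alpha < 1)
  (cg_gt0 : 0 < cg)
  (Xs : nat -> {RV P >-> borel H})
  (indep_Xs : mutually_independent (fun n => Xs n.+1))
  (law_Xs : forall n, (1 <= n)%N -> same_law (Xs n) X)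
  (Z : nat -> T -> H)
  (Z1_bounded : exists M : R, forall w, `|Z 1%N w| <= M)
  (Z1_measurable : sigma_of (Z 1%N) `<=` sigma_of (Xs 1%N))
  (Z_rec : stochastic_gradient (step_size cg alpha) (fun n => Xs n) Z) :
  forall p : nat, (1 <= p)%N ->
  exists2 A : R, 0 < A & forall n : nat, (1 <= n)%N ->
    ('E_P[fun w => (`|averaged Z n w - m| ^+ (2 * p))%R]
       <= (A / n%:R ^+ p)%:E)%E.
Proof.
case=> // p _.
have slow := step_size_slow alpha_gt alpha_lt cg_gt0.
have unbounded := step_size_unbounded alpha_lt cg_gt0.
have [C C0 hC] := average_moments hilbertH separableH A1 A2 median_m indep_Xs law_Xs
  slow unbounded Z1_bounded Z1_measurable Z_rec p.
exists C => // n n1; have n0 : 0 < n%:R :> R by rewrite ltr0n.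
have avgE w : averaged Z n w - m = n%:R^-1 *: \sum_(0 <= k < n) (Z k.+1 w - m).
  rewrite /averaged big_add1/= sumrB scalerBr sumr_const_nat subn0 -(scaler_nat n m).
  by rewrite scalerA mulVf ?scale1r// gt_eqF.
have bS : bounded_rv (fun w => `|\sum_(0 <= k < n) (Z k.+1 w - m)| ^+ (2 * p.+1)).
  apply: bounded_rvX; split.
    apply: measurable_norm => //; apply: measurable_sumv => // k.
    apply: measurable_subv => //.
    exact (adapted_measurable (adapted_iterate separableH Z1_measurable Z_rec (ltn0Sn k))).
  have [_ [N hN]] : bounded_rv (fun w => \sum_(0 <= k < n) `|Z k.+1 w - m|).
    apply: bounded_rv_sum => k; apply: (@bounded_rv_past _ _ _ _ _ Xs k.+1).
    exact: (bounded_dist separableH m Z1_bounded Z1_measurable Z_rec).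
  exists N => w; rewrite normr_id; apply: le_trans (ler_norm_sum _ _ _) _.
  by apply: le_trans (hN w); exact: ler_norm.
rewrite unlock.
under eq_integral do rewrite avgE normrZ exprMn normfV normr_nat.
have -> : (\int[P]_w (n%:R^-1 ^+ (2 * p.+1) *
      `|\sum_(0 <= k < n) (Z k.+1 w - m)| ^+ (2 * p.+1))%:E =
    (Rintegral P setT (fun w => n%:R^-1 ^+ (2 * p.+1) *
      `|\sum_(0 <= k < n) (Z k.+1 w - m)| ^+ (2 * p.+1)))%:E)%E.
  rewrite /Rintegral fineK//; apply: integrable_fin_num => //.
  by apply: bounded_rv_integrable; exact: bounded_rvZ.
rewrite lee_fin (ERZ P)//.
apply: le_trans (ler_wpM2l _ (hC n n1)) _; first by rewrite exprn_ge0// invr_ge0 ltW.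
rewrite le_eqVlt; apply/orP; left; apply/eqP.
by rewrite mul2n -addnn exprD exprVn; field; rewrite gt_eqF// exprn_gt0.
Qed.
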